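(* Assume $m_0\boldsymbol I\le\boldsymbol M(\boldsymbol x)\le m_1\boldsymbol I$ for a.e. $\boldsymbol x\in\Omega_p$ with constants $m_0,m_1>0$, and let $\boldsymbol g\in W^{1-1/q,q}(\partial\Omega_p;\mathbb R^d)$. Set $$\rho_0:=m_0^{d/2},\qquad \rho_1:=m_1^{d/2},\qquad C_{c,\theta}:=d^p\theta^p\Bigl[\log\Bigl(\frac{\theta^p}{1-c}\Bigr)-1\Bigr]_+,\quad c\in(0,1).$$ For almost every $\boldsymbol x\in\Omega_p$, every $\boldsymbol A\in\operatorname{SPD}(d)$, every $\boldsymbol P\in\mathbb R^{d\times d}$ with $\det\boldsymbol P>0$, and every $c\in(0,1)$, $$G(\boldsymbol A,\det\boldsymbol A,\boldsymbol M)\ \ge\ c\rho_0[\operatorname{tr}(\boldsymbol A)]^p-\rho_1C_{c,\theta},$$ $$G\bigl(\boldsymbol P\boldsymbol M^{-1}\boldsymbol P^T,\det(\boldsymbol P\boldsymbol M^{-1}\boldsymbol P^T),\boldsymbol M\bigr)\ \ge\ c\rho_0m_1^{-p}\|\boldsymbol P\|_F^q-\rho_1C_{c,\theta}.$$ Consequently, for each fixed $c\in(0,1)$ there are $c_I>0$ and $C_I\ge0$, depending only on $c,q,m_0,m_1,\theta,\Omega_p$ and $\|\boldsymbol g\|_{W^{1-1/q,q}(\partial\Omega_p)}$, such that $$I[\boldsymbol\xi]\ \ge\ c_I\|\boldsymbol\xi\|_{W^{1,q}(\Omega_p)}^q-C_I,\qquad \boldsymbol\xi\in\mathcal A_g^0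 .$$
   Context: Let $d\ge2$, let $\Omega_p\subset\mathbb R^d$ be a bounded polygonal or polyhedral domain and $\Omega_c\subset\mathbb R^d$ the computational domain (with finite positive measure $|\Omega_c|$). $\boldsymbol M=\boldsymbol M(\boldsymbol x)$ is a symmetric positive-definite matrix field on $\Omega_p$; $\rho(\boldsymbol x)=\sqrt{\det\boldsymbol M(\boldsymbol x)}$, $\sigma=\int_{\Omega_p}\rho\,d\boldsymbol x$, $\theta=(\sigma/|\Omega_c|)^{-2/d}$, $\gamma>1$, $p=d\gamma/2$, $q:=2p=d\gamma$, $\kappa_\theta=p\,d^{p-1}\theta^p$. $\operatorname{SPD}(d)$ is the cone of real symmetric positive-definite $d\times d$ matrices, $\|\cdot\|_F$ the Frobenius norm, and $[s]_+=\max\{s,0\}$. The density is $$G(\boldsymbol A,a,\boldsymbol M)=\rho\,\bigl([\operatorname{tr}(\boldsymbol A)]^p-\kappa_\theta\log a\bigr),\qquad \boldsymbol A\in\operatorname{SPD}(d),\ a>0 .$$ For $\boldsymbol\xi\in W^{1,q}(\Omega_p;\mathbb R^d)$ the functional is $I[\boldsymbol\xi]=\int_{\Omega_p}W_{\boldsymbol x}(\nabla\boldsymbol\xi(\boldsymbol x))\,d\boldsymbol x$, where $W_{\boldsymbol x}(\boldsymbol P)=G(\boldsymbol P\boldsymbol M^{-1}\boldsymbol P^T,\det(\boldsymbol P\boldsymbol M^{-1}\boldsymbol P^T),\boldsymbol M)$ with $\boldsymbol M=\boldsymbol M(\boldsymbol x)$ if $\det\boldsymbol P>0$, and $W_{\boldsymbol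 x}(\boldsymbol P)=+\infty$ if $\det\boldsymbol P\le0$ (here $\boldsymbol P=\nabla\boldsymbol\xi=\boldsymbol J^{-1}$ is the inverse Jacobian). The admissible class is $\mathcal A_g^0:=\{\boldsymbol\xi\in W^{1,q}(\Omega_p;\mathbb R^d):\operatorname{Tr}\boldsymbol\xi=\boldsymbol g\}$, with $\operatorname{Tr}$ the Sobolev trace on $\partial\Omega_p$. *)

(* Defs.v *)
From HB Require Import structures.
From mathcomp Require Import all_boot all_order all_algebra.
From mathcomp Require Import all_classical all_reals all_analysis.

Set Implicit Arguments.
Unset Strict Implicit.
Unset Printing Implicit Defensive.

Import Order.TTheory GRing.Theory Num.Theory.
Import numFieldNormedType.Exports.

Local Open Scope classical_set_scope.
Local Open Scope ring_scope.

(** R^n is the normed space ['rV[R]_n] of row vectors.  Matrices carry the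
    product of the Borel sigma-algebras of their entries; the n-fold product
    of the one-dimensional Lebesgue measure is built by recursion on n, and
    its outer measure restricted to the Caratheodory sets is its completion,
    i.e. the Lebesgue measure on the Lebesgue sigma-algebra. *)

Definition mx_cylinder (R : realType) (m n : nat) : set (set 'M[R]_(m, n)) :=
  [set A | exists (i : 'I_m) (j : 'I_n) (B : set R),
     measurable B /\ A = [set M : 'M[R]_(m, n) | B (M i j)]].

Definition mx_display : measure_display.
Proof. exact: default_measure_display. Qed.

HB.instance Definition _ (R : realType) (m n : nat) :=
  @isMeasurable.Build mx_display 'M[R]_(m, n) <<s @mx_cylinder R m n >>
    (@sigma_algebra0 _ setT (@mx_cylinder R m n))
    (@sigma_algebraC _ (@mx_cylinder R m n))
    (@sigma_algebra_bigcup _ setT (@mx_cylinder R m n)).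

Lemma measurable_entry (R : realType) m n (i : 'I_m) (j : 'I_n) :
  measurable_fun setT (fun M : 'M[R]_(m, n) => M i j).
Proof.
move=> _ B mB; rewrite setTI; apply: sub_sigma_algebra.
by exists i, j, B.
Qed.

Lemma measurable_fun_mx d (T : measurableType d) (R : realType) m n
    (D : set T) (f : T -> 'M[R]_(m, n)) :
  (forall i j, measurable_fun D (fun x => f x i j)) -> measurable_fun D f.
Proof.
move=> mf mD; apply: (measurability (@mx_cylinder R m n)) => //.
by move=> _ [_ [i [j [B [mB ->]]]] <-]; exact: mf.
Qed.

Definition consv (R : realType) (n : nat) (tv : measurableTypeR R * 'rV[R]_n) :
    'rV[R]_n.+1 :=
  row_mx (const_mx tv.1 : 'rV_1) tv.2.

Lemma measurable_consv (R : realType) n : measurable_fun setT (@consv R n).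
Proof.
apply: measurable_fun_mx => i j; rewrite /consv.
have [[k ->]|[k ->]] :
    (exists k : 'I_1, j = lshift n k) \/ (exists k : 'I_n, j = rshift 1 k).
- by case: (@split_ordP 1 n j) => k ->; [left|right]; exists k.
- rewrite (_ : (fun _ => _) = fst); first exact: measurable_fst.
  by apply/funext => x; rewrite (@row_mxEl _ 1 1 n) mxE.
- rewrite (_ : (fun _ => _) = (fun v : 'rV_n => v i k) \o snd); last first.
    by apply/funext => x; rewrite (@row_mxEr _ 1 1 n).
  exact: measurableT_comp (measurable_entry _ _) measurable_snd.
Qed.

Section product_step.
Context (R : realType) (n : nat).
Variable mu : {sigma_finite_measure set 'rV[R]_n -> \bar R}.
Local Open Scope ereal_scope.

Definition lebesgue_step : set 'rV[R]_n.+1 -> \bar R :=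
  pushforward (lebesgue_measure \x mu) (@consv R n).

Let lebesgue_step0 : lebesgue_step set0 = 0.
Proof. by rewrite /lebesgue_step /pushforward preimage_set0 measure0. Qed.

Let lebesgue_step_ge0 A : 0 <= lebesgue_step A.
Proof. by rewrite /lebesgue_step /pushforward. Qed.

Let mconsv (A : set 'rV[R]_n.+1) :
  measurable A -> measurable (@consv R n @^-1` A).
Proof.
by move=> mA; rewrite -[X in measurable X]setTI; exact: measurable_consv.
Qed.

Let lebesgue_step_sigma_additive : semi_sigma_additive lebesgue_step.
Proof.
move=> F mF tF mUF; rewrite /lebesgue_step /pushforward preimage_bigcup.
apply: measure_semi_sigma_additive.
- by move=> i; exact: mconsv.
- apply/trivIsetP => /= i j _ _ ij; rewrite -preimage_setI.
  by move/trivIsetP : tF => /(_ _ _ _ _ ij) ->//; rewrite preimage_set0.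
- by rewrite -preimage_bigcup; exact: mconsv.
Qed.

HB.instance Definition _ := isMeasure.Build _ _ _ lebesgue_step
  lebesgue_step0 lebesgue_step_ge0 lebesgue_step_sigma_additive.

Let lebesgue_step_sigma_finite : sigma_finite setT lebesgue_step.
Proof.
pose unc (v : 'rV[R]_n.+1) : measurableTypeR R * 'rV[R]_n :=
  (v ord0 ord0, \row_j v ord0 (rshift 1 j)).
have munc : measurable_fun setT unc.
  apply: measurable_fun_pair; first exact: measurable_entry.
  apply: measurable_fun_mx => i j.
  rewrite (_ : (fun _ => _) = fun v : 'rV[R]_n.+1 => v ord0 (rshift 1 j)).
    exact: measurable_entry.
  by apply/funext => v; rewrite mxE.
have /sigma_finiteP[F [TF ndF Foo]] := sigma_finiteT (@lebesgue_measure R).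
have /sigma_finiteP[G [TG ndG Goo]] := sigma_finiteT mu.
exists (fun i => unc @^-1` (F i `*` G i)).
  apply/esym; rewrite -subTset => v _.
  have [i _ Fi] : (\bigcup_i F i) (unc v).1 by rewrite -TF.
  have [k _ Gk] : (\bigcup_i G i) (unc v).2 by rewrite -TG.
  exists (maxn i k) => //; split => /=.
  - by move: Fi; exact/subsetPset/ndF/leq_maxl.
  - by move: Gk; exact/subsetPset/ndG/leq_maxr.
move=> i; have [mFi Fioo] := Foo i; have [mGi Gioo] := Goo i.
have mFG : measurable (F i `*` G i) by exact: measurableX.
split; first by rewrite -[X in measurable X]setTI; exact: munc.
rewrite /lebesgue_step /pushforward -comp_preimage.
rewrite (_ : unc \o _ = id) ?preimage_id.
  by rewrite product_measure1E// lte_mul_pinfty// ge0_fin_numE.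
apply/funext => -[t v]; rewrite /= /unc /consv/=; congr pair.
  rewrite (_ : ord0 = lshift n ord0 :> 'I_(1 + n)); last exact/val_inj.
  by rewrite (@row_mxEl _ 1 1 n) mxE.
by apply/rowP => j; rewrite mxE (@row_mxEr _ 1 1 n).
Qed.

HB.instance Definition _ := Measure_isSigmaFinite.Build _ _ _ lebesgue_step
  lebesgue_step_sigma_finite.
End product_step.

Fixpoint lebesgue_borel (R : realType) (n : nat) :
    {sigma_finite_measure set 'rV[R]_n -> \bar R} :=
  match n with
  | 0%N => \d_(0 : 'rV[R]_0)
  | n'.+1 => lebesgue_step (lebesgue_borel R n')
  end.

Definition lebesgue_outer (R : realType) (n : nat) :
    {outer_measure set 'rV[R]_n -> \bar R} :=
  mu_ext (lebesgue_borel R n).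

Notation lebesgueType R n := (caratheodory_type (lebesgue_outer R n)).

Definition leb (R : realType) (n : nat) :
    {measure set (lebesgueType R n) -> \bar R} :=
  (lebesgue_outer R n : set (lebesgueType R n) -> \bar R).

Definition frob (R : realType) (m n : nat) (A : 'M[R]_(m, n)) : R :=
  Num.sqrt (\sum_i \sum_j A i j ^+ 2).

Lemma frob_ge0 (R : realType) m n (A : 'M[R]_(m, n)) : 0 <= frob A.
Proof. exact: sqrtr_ge0. Qed.

Definition discrete_type (T : Type) : Type := T.

HB.instance Definition _ (T : pointedType) := Pointed.on (discrete_type T).
HB.instance Definition _ (T : pointedType) :=
  @isMeasurable.Build default_measure_display (discrete_type T)
    discrete_measurable discrete_measurable0
    discrete_measurableC discrete_measurableU.

Section hausdorff.
Context (R : realType) (n k : nat).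
Local Open Scope ereal_scope.
Local Notation E := (discrete_type 'rV[R]_n).

Definition diam (U : set 'rV[R]_n) : \bar R :=
  ereal_sup [set (frob (x - y)%R)%:E | x in U & y in U].

(** Volume of the k-dimensional ball of diameter 1, so that the k-dimensional
    Hausdorff measure is k-dimensional area on k-dimensional planes. *)
Definition ball_volume : R :=
  (fine (leb R k [set v | (frob v <= 1)%R]) / 2 ^+ k)%R.

Definition hausdorff_gauge (delta : R) (U : set E) : \bar R :=
  if U == set0 then 0
  else if diam U <= delta%:E then ball_volume%:E * diam U ^+ k
  else +oo.

Lemma hausdorff_gauge0 delta : hausdorff_gauge delta set0 = 0.
Proof. by rewrite /hausdorff_gauge eqxx. Qed.

Lemma hausdorff_gauge_ge0 delta U : 0 <= hausdorff_gauge delta U.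
Proof.
rewrite /hausdorff_gauge; case: eqVneq => // /set0P[x Ux].
case: ifPn => // _; apply: mule_ge0.
  by rewrite lee_fin divr_ge0// ?exprn_ge0// fine_ge0.
apply: expe_ge0; apply: le_ereal_sup_tmp.
by exists (frob (x - x)%R)%:E; [exists x => //; exists x|rewrite lee_fin frob_ge0].
Qed.

(** [discrete_type] makes every set measurable, so the infimum runs over all
    countable covers by arbitrary sets of diameter <= delta. *)
Definition hausdorff_pre (delta : R) : set 'rV[R]_n -> \bar R :=
  @mu_ext _ E R (hausdorff_gauge delta).

Definition hausdorff (A : set 'rV[R]_n) : \bar R :=
  ereal_sup [set hausdorff_pre delta A | delta in [set x : R | (0 < x)%R]].

Lemma hausdorff_pre_le delta A : (0 < delta)%R ->
  hausdorff_pre delta A <= hausdorff A.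
Proof. by move=> d0; apply: ereal_sup_ubound; exists delta. Qed.

Let hausdorff_ge0 A : 0 <= hausdorff A.
Proof.
apply: le_trans (hausdorff_pre_le A ltr01).
exact/mu_ext_ge0/hausdorff_gauge_ge0.
Qed.

Let hausdorff0 : hausdorff set0 = 0.
Proof.
apply/eqP; rewrite eq_le hausdorff_ge0 andbT.
apply: ge_ereal_sup => _ [delta _ <-]; rewrite /hausdorff_pre mu_ext0//.
- exact: hausdorff_gauge0.
- exact: hausdorff_gauge_ge0.
Qed.

Let le_hausdorff : {homo hausdorff : A B / A `<=` B >-> A <= B}.
Proof.
move=> A B AB; apply: ge_ereal_sup => _ [delta d0 <-].
by apply: le_trans (hausdorff_pre_le B d0); exact: le_mu_ext.
Qed.

Let hausdorff_sigma_subadditive : sigma_subadditive hausdorff.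
Proof.
move=> F; apply: ge_ereal_sup => _ [delta d0 <-].
apply: le_trans.
  exact: (mu_ext_sigma_subadditive (hausdorff_gauge_ge0 delta)).
apply: lee_nneseries => [i _ _|i _].
  exact/mu_ext_ge0/hausdorff_gauge_ge0.
exact: hausdorff_pre_le.
Qed.

HB.instance Definition _ := isOuterMeasure.Build R 'rV[R]_n hausdorff
  hausdorff0 hausdorff_ge0 le_hausdorff hausdorff_sigma_subadditive.

End hausdorff.
Arguments hausdorff : clear implicits.

(** Surface measure on boundaries in R^d: Hausdorff measure of dimension d - 1,
    used for d >= 2 only. *)
Definition surface_outer (R : realType) (d : nat) :
  {outer_measure set 'rV[R]_d -> \bar R} := hausdorff R d d.-1.

Notation surfaceType R d := (caratheodory_type (surface_outer R d)).

Definition surf (R : realType) (d : nat) :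
    {measure set (surfaceType R d) -> \bar R} :=
  (surface_outer R d : set (surfaceType R d) -> \bar R).

Definition partial (R : realType) (d : nat) (j : 'I_d) (f : 'rV[R]_d -> R) :
    'rV[R]_d -> R :=
  fun x => 'D_(delta_mx ord0 j) f x.

(** Every iterated partial derivative is Frechet differentiable everywhere,
    i.e. [f] is C^infinity. *)
Definition smooth (R : realType) (d : nat) (f : 'rV[R]_d -> R) : Prop :=
  forall (js : seq 'I_d) (x : 'rV[R]_d),
    differentiable (foldr (@partial R d) f js) x.

Definition test_function (R : realType) (d : nat) (Omega : set 'rV[R]_d)
    (phi : 'rV[R]_d -> R) : Prop :=
  smooth phi /\
  exists K : set 'rV[R]_d,
    [/\ compact K, K `<=` Omega & forall x, ~ K x -> phi x = 0].

(** Row i is the gradient of the i-th component. *)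
Definition jacobian (R : realType) (d : nat) (f : 'rV[R]_d -> 'rV[R]_d) :
    'rV[R]_d -> 'M[R]_d :=
  fun x => \matrix_(i, j) partial j (fun y => f y ord0 i) x.

Definition leb_measurable (R : realType) (d m n : nat) (D : set 'rV[R]_d)
    (f : 'rV[R]_d -> 'M[R]_(m, n)) : Prop :=
  measurable_fun (D : set (lebesgueType R d))
    (f : lebesgueType R d -> 'M[R]_(m, n)).

Definition loc_integrable (R : realType) (d m n : nat) (Omega : set 'rV[R]_d)
    (f : 'rV[R]_d -> 'M[R]_(m, n)) : Prop :=
  leb_measurable Omega f /\
  forall K : set 'rV[R]_d, compact K -> K `<=` Omega ->
    (\int[leb R d]_(x in K) (frob (f x))%:E < +oo)%E.

(** Only the values on [Omega] of functions on [Omega] are relevant. *)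
Definition weak_gradient (R : realType) (d : nat) (Omega : set 'rV[R]_d)
    (xi : 'rV[R]_d -> 'rV[R]_d) (D : 'rV[R]_d -> 'M[R]_d) : Prop :=
  [/\ loc_integrable Omega xi, loc_integrable Omega D &
    forall (i j : 'I_d) (phi : 'rV[R]_d -> R), test_function Omega phi ->
      (\int[leb R d]_(x in Omega) (xi x ord0 i * partial j phi x)%:E =
       - \int[leb R d]_(x in Omega) (D x i j * phi x)%:E)%E].

(** The weak gradient (unique up to a null set), as a chosen representative. *)
Definition wgrad (R : realType) (d : nat) (Omega : set 'rV[R]_d)
    (xi : 'rV[R]_d -> 'rV[R]_d) : 'rV[R]_d -> 'M[R]_d :=
  xget (fun=> 0) [set D | weak_gradient Omega xi D].

Definition Lq_pow (R : realType) (d m n : nat) (Omega : set 'rV[R]_d) (q : R)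
    (f : 'rV[R]_d -> 'M[R]_(m, n)) : \bar R :=
  (\int[leb R d]_(x in Omega) (frob (f x) `^ q)%:E)%E.

Definition in_Lq (R : realType) (d m n : nat) (Omega : set 'rV[R]_d) (q : R)
    (f : 'rV[R]_d -> 'M[R]_(m, n)) : Prop :=
  leb_measurable Omega f /\ (Lq_pow Omega q f < +oo)%E.

Definition W1q (R : realType) (d : nat) (Omega : set 'rV[R]_d) (q : R)
    (xi : 'rV[R]_d -> 'rV[R]_d) : Prop :=
  [/\ in_Lq Omega q xi, exists D, weak_gradient Omega xi D
    & in_Lq Omega q (wgrad Omega xi)].

Definition W1q_norm (R : realType) (d : nat) (Omega : set 'rV[R]_d) (q : R)
    (xi : 'rV[R]_d -> 'rV[R]_d) : \bar R :=
  ((Lq_pow Omega q xi + Lq_pow Omega q (wgrad Omega xi)) `^ q^-1)%E.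

Definition bdry (R : realType) (d : nat) (Omega : set 'rV[R]_d) : set 'rV[R]_d :=
  closure Omega `\` interior Omega.

(** Gagliardo-Slobodeckij norm of order s = 1 - 1/q on the (d-1)-dimensional
    set [bdry Omega]; the kernel exponent is (d - 1) + s q = d + q - 2. *)
Definition bdry_norm (R : realType) (d : nat) (Omega : set 'rV[R]_d) (q : R)
    (g : 'rV[R]_d -> 'rV[R]_d) : \bar R :=
  ((\int[surf R d]_(x in bdry Omega) (frob (g x) `^ q)%:E
   + \int[surf R d]_(x in bdry Omega) \int[surf R d]_(y in bdry Omega)
       (frob (g x - g y)%R `^ q / frob (x - y)%R `^ (d%:R + q - 2))%:E) `^ q^-1)%E.

Definition bdry_space (R : realType) (d : nat) (Omega : set 'rV[R]_d) (q : R)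
    (g : 'rV[R]_d -> 'rV[R]_d) : Prop :=
  measurable_fun (bdry Omega : set (surfaceType R d))
    (g : surfaceType R d -> 'rV[R]_d) /\
  (bdry_norm Omega q g < +oo)%E.

(** [Tr xi = g]: the trace is the continuous extension to W^{1,q}(Omega), with
    values in L^q(bdry Omega), of the restriction to the boundary of functions
    that are smooth up to the boundary. *)
Definition has_trace (R : realType) (d : nat) (Omega : set 'rV[R]_d) (q : R)
    (xi g : 'rV[R]_d -> 'rV[R]_d) : Prop :=
  exists phi : nat -> 'rV[R]_d -> 'rV[R]_d,
    [/\ forall k i, smooth (fun x => phi k x ord0 i),
      Lq_pow Omega q (fun x => phi k x - xi x) @[k --> \oo] --> 0%E,
      Lq_pow Omega q (fun x => jacobian (phi k) x - wgrad Omega xi x)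
        @[k --> \oo] --> 0%E
    & (\int[surf R d]_(x in bdry Omega) (frob (phi k x - g x)%R `^ q)%:E)%E
        @[k --> \oo] --> 0%E].

Definition admissible (R : realType) (d : nat) (Omega : set 'rV[R]_d) (q : R)
    (g : 'rV[R]_d -> 'rV[R]_d) : set ('rV[R]_d -> 'rV[R]_d) :=
  [set xi | W1q Omega q xi /\ has_trace Omega q xi g].

Definition domain (R : realType) (d : nat) (Omega : set 'rV[R]_d) : Prop :=
  [/\ open Omega, connected Omega & Omega !=set0].

Definition halfspaces (R : realType) (d : nat) (H : seq ('rV[R]_d * R)) :
    set 'rV[R]_d :=
  [set x | forall h, h \in H -> (h.1 *m x^T) ord0 ord0 <= h.2].

(** Polygons, polyhedra and their analogues in higher dimension: the closure is
    a finite union of convex polyhedra, and the domain has no slits. *)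
Definition polyhedral_domain (R : realType) (d : nat) (Omega : set 'rV[R]_d) :
    Prop :=
  [/\ domain Omega, bounded_set Omega, interior (closure Omega) = Omega
    & exists Hs : seq (seq ('rV[R]_d * R)),
        closure Omega = [set x | exists2 H, H \in Hs & halfspaces H x]].

Definition loewner (R : realType) (d : nat) (A B : 'M[R]_d) : Prop :=
  forall v : 'cV[R]_d, (v^T *m A *m v) ord0 ord0 <= (v^T *m B *m v) ord0 ord0.

Definition SPD (R : realType) (d : nat) (A : 'M[R]_d) : Prop :=
  A^T = A /\ forall v : 'cV[R]_d, v != 0 -> 0 < (v^T *m A *m v) ord0 ord0.

Definition SPD_field (R : realType) (d : nat) (Omega : set 'rV[R]_d)
    (M : 'rV[R]_d -> 'M[R]_d) : Prop :=
  leb_measurable Omega M /\ forall x, Omega x -> SPD (M x).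

Definition uniform_bounds (R : realType) (d : nat) (Omega : set 'rV[R]_d)
    (m0 m1 : R) (M : 'rV[R]_d -> 'M[R]_d) : Prop :=
  {ae leb R d, forall x, Omega x -> loewner m0%:M (M x) /\ loewner (M x) m1%:M}.

Definition rho (R : realType) (d : nat) (M : 'M[R]_d) : R := Num.sqrt (\det M).

Definition sigma_of (R : realType) (d : nat) (Omega : set 'rV[R]_d)
    (M : 'rV[R]_d -> 'M[R]_d) : R :=
  fine (\int[leb R d]_(x in Omega) (rho (M x))%:E)%E.

Definition theta_of (R : realType) (d : nat) (Omegap Omegac : set 'rV[R]_d)
    (M : 'rV[R]_d -> 'M[R]_d) : R :=
  (sigma_of Omegap M / fine (leb R d Omegac)) `^ (- (2 / d%:R)).

Definition kappa (R : realType) (d : nat) (p theta : R) : R :=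
  p * d%:R `^ (p - 1) * theta `^ p.

Definition G_density (R : realType) (d : nat) (p theta : R)
    (A : 'M[R]_d) (a : R) (M : 'M[R]_d) : R :=
  rho M * ((\tr A) `^ p - kappa d p theta * ln a).

Definition W_density (R : realType) (d : nat) (p theta : R)
    (M P : 'M[R]_d) : \bar R :=
  if 0 < \det P then
    let A := P *m invmx M *m P^T in (G_density p theta A (\det A) M)%:E
  else +oo%E.

Definition I_functional (R : realType) (d : nat) (Omega : set 'rV[R]_d)
    (p theta : R) (M : 'rV[R]_d -> 'M[R]_d) (xi : 'rV[R]_d -> 'rV[R]_d) :
    \bar R :=
  (\int[leb R d]_(x in Omega) W_density p theta (M x) (wgrad Omega xi x))%E.

Definition C_const (R : realType) (d : nat) (p theta c : R) : R :=
  d%:R `^ p * theta `^ p * Num.max (ln (theta `^ p / (1 - c)) - 1) 0.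

(* Main.v *)
Require Import Defs.
From mathcomp Require Import all_boot all_order all_algebra.
From mathcomp Require Import all_classical all_reals all_analysis.
From mathcomp Require Import measurable_realfun ring lra.
Import Order.TTheory GRing.Theory Num.Theory.
Import numFieldNormedType.Exports.
Set Implicit Arguments.
Unset Strict Implicit.
Unset Printing Implicit Defensive.
Local Open Scope classical_set_scope.
Local Open Scope ring_scope.

(** The pointwise bounds compare two terms of different growth. The AM-GM
    inequality [det A <= (tr A / d)^d] turns the logarithmic term into
    [d^p theta^p ln s], where [s = (tr A / d)^p] and [(tr A)^p = d^p s], so the
    density divided by [rho] is at least [d^p (s - theta^p ln s)]. The tangent
    line inequality for [ln] bounds [(1 - c) s - theta^p ln s] from below by a
    constant ([linear_log_ge]). The bounds on [rho] come from
    [m0^d <= det M <= m1^d], and the passage from the trace of [P M^-1 P^T] to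
    the Frobenius norm of [P] from [M^-1 >= m1^-1 I]. The determinant
    inequalities, including [det A <= prod_i A i i], are proved by induction on
    the dimension with Schur complements, without diagonalization.

    Integrating the second bound gives [I >= a |grad xi|_q^q - const], and it
    remains to control the L^q norm of [xi] by its gradient and its trace
    ([trace_poincare]). By density this is an inequality for smooth [phi], and
    it may contain an additive constant, because only one term of the
    approximating sequence, with errors at most 1, is needed.

    For smooth [phi], move from a point of the domain in the first coordinate
    direction until the first exit. The fundamental theorem of calculus and
    Jensen's inequality bound [|phi|^q] by its value at the exit point plus the
    integral of [|grad phi|^q] over the slice ([slice_exit_bound],
    [jensen_powR]). Integrating over all lines with Tonelli's theorem, it
    remains to bound the integral over [y] of the supremum of [|phi|^q] over
    the boundary points which project to [y]. This supremum is bounded by a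
    dyadic sum of indicators of Borel hulls of the projections of the sets where
    [|phi|^q > 2^j] on the boundary. Such a hull has Lebesgue measure at most a constant times the Hausdorff measure of
    the set, directly from the definition of the latter by coverings
    ([hausdorff_projection]).

    To integrate continuous functions against the Hausdorff measure, Borel sets
    have to be Caratheodory measurable; this is Caratheodory's criterion, in the
    form of [sublevel_caratheodory] applied to the coordinate functions. *)

(** * Determinants of positive definite matrices *)

Section quadratic_forms.
Context (R : realType).
Implicit Types n : nat.

Definition qform n (A : 'M[R]_n) (v : 'cV[R]_n) : R := (v^T *m A *m v) ord0 ord0.

Lemma qform_scalar n (a : R) (v : 'cV[R]_n) :
  qform a%:M v = a * \sum_i v i ord0 ^+ 2.
Proof.
rewrite /qform mul_mx_scalar -scalemxAl mxE; congr (_ * _).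
by rewrite mxE; apply: eq_bigr => i _; rewrite mxE expr2.
Qed.

Lemma qform_delta n (A : 'M[R]_n) i : qform A (delta_mx i ord0) = A i i.
Proof. by rewrite /qform trmx_delta -rowE -colE !mxE. Qed.

Lemma qformB n (A : 'M[R]_n) (v w : 'cV[R]_n) (t : R) : A^T = A ->
  qform A (v - t *: w) =
  qform A v - 2 * t * (w^T *m A *m v) ord0 ord0 + t ^+ 2 * qform A w.
Proof.
move=> sA; have vw : v^T *m A *m w = w^T *m A *m v.
  rewrite [RHS]mx11_scalar -tr_scalar_mx -mx11_scalar.
  by rewrite !trmx_mul trmxK sA mulmxA.
rewrite /qform (_ : (v - t *: w)^T = v^T - t *: w^T); last by rewrite linearB/= linearZ.
rewrite !mulmxBl !mulmxBr -!scalemxAl -!scalemxAr.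
rewrite -?scalemxAl -?scalemxAr; rewrite vw !mxE; ring.
Qed.

Definition schur n (A : 'M[R]_(1 + n)) : 'M[R]_n :=
  drsubmx A - (A ord0 ord0)^-1 *: (dlsubmx A *m ursubmx A).

Lemma ulsubmx_11 n (A : 'M[R]_(1 + n)) : ulsubmx A = (A ord0 ord0)%:M.
Proof.
rewrite [LHS]mx11_scalar; congr (_%:M); rewrite !mxE; congr (A _ _); exact/val_inj.
Qed.

Lemma det_schur n (A : 'M[R]_(1 + n)) : A ord0 ord0 != 0 ->
  \det A = A ord0 ord0 * \det (schur A).
Proof.
move=> a0; set a := A ord0 ord0.
have eA : A = block_mx 1%:M 0 (a^-1 *: dlsubmx A) 1%:M *m
              block_mx a%:M (ursubmx A) 0 (schur A).
  rewrite mulmx_block !mul0mx !mulmx0 !mul1mx !addr0 -{1}(submxK A); congr block_mx.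
  - by rewrite ulsubmx_11.
  - by rewrite mul_mx_scalar scalerA divff// scale1r.
  - by rewrite /schur -scalemxAl addrC subrK.
by rewrite [in LHS]eA det_mulmx det_lblock det_ublock !det1 !mul1r det_scalar1.
Qed.

(** The first coordinate of the vector is chosen to minimize the quadratic form
    of [A]; the minimum is the form of the Schur complement. Hence positivity
    and lower bounds pass from [A] to [schur A]. *)
Lemma qform_block n (A : 'M[R]_(1 + n)) (w : 'cV[R]_n) :
  A^T = A -> A ord0 ord0 != 0 ->
  qform A (col_mx (- (A ord0 ord0)^-1 *: (ursubmx A *m w)) w) = qform (schur A) w.
Proof.
move=> sA a0; rewrite /qform; congr (_ _ ord0 ord0); set a := A ord0 ord0.
rewrite -mulmxA -[X in X *m col_mx _ _]submxK (@mul_block_col _ 1 n 1 n).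
rewrite tr_col_mx mul_row_col ulsubmx_11 -/a.
rewrite mul_scalar_mx scalerA mulrN divff// scaleN1r addNr mulmx0 add0r.
rewrite -mulmxA; congr (_ *m _).
by rewrite /schur mulmxBl -/a -scalemxAl -scalemxAr scaleNr addrC mulmxA.
Qed.

Lemma schur_sym n (A : 'M[R]_(1 + n)) : A^T = A -> (schur A)^T = schur A.
Proof.
move=> sA; rewrite /schur linearB/= linearZ/= trmx_mul.
by rewrite trmx_drsub trmx_ursub trmx_dlsub sA.
Qed.

Lemma SPD_diag n (A : 'M[R]_n) i : SPD A -> 0 < A i i.
Proof.
move=> [_ /(_ (delta_mx i ord0))]; rewrite -/(qform _ _) qform_delta; apply.
by apply/eqP => /matrixP/(_ i ord0); rewrite !mxE !eqxx => /eqP; rewrite oner_eq0.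
Qed.

Lemma SPD_schur n (A : 'M[R]_(1 + n)) : SPD A -> SPD (schur A).
Proof.
move=> pA; have a0 := SPD_diag ord0 pA; case: pA => sA pA.
split=> [|w w0]; first exact: schur_sym.
rewrite -/(qform _ _) -qform_block ?gt_eqF//; apply: pA.
by apply: contra_neq w0; rewrite -[RHS](@col_mx0 _ 1 n) => /eq_col_mx[].
Qed.

Lemma loewner_schur n (m : R) (A : 'M[R]_(1 + n)) : 0 <= m -> SPD A ->
  loewner m%:M A -> loewner m%:M (schur A).
Proof.
move=> m0 pA mA w; have a0 := SPD_diag ord0 pA; case: pA => sA _.
rewrite -!/(qform _ _) -qform_block ?gt_eqF//; apply: le_trans (mA _).
rewrite -!/(qform _ _) !qform_scalar ler_wpM2l// big_split_ord/=.
rewrite -[leLHS]add0r lerD ?sumr_ge0//; first by move=> i _; exact: sqr_ge0.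
by apply: ler_sum => i _; rewrite col_mxEd.
Qed.

(** The Schur complement subtracts a positive multiple of a square from each
    diagonal entry. *)
Lemma schur_diag_le n (A : 'M[R]_(1 + n)) i : SPD A ->
  schur A i i <= A (rshift 1 i) (rshift 1 i).
Proof.
move=> pA; have a0 := SPD_diag ord0 pA; case: pA => sA _.
have -> : schur A i i = A (rshift 1 i) (rshift 1 i) -
    (A ord0 ord0)^-1 * (ursubmx A ord0 i) ^+ 2.
  rewrite /schur !mxE; congr (_ - _ * _); rewrite big_ord1 !mxE expr2; congr (_ * _).
  by rewrite -[in LHS]sA mxE.
by rewrite lerBlDr lerDl mulr_ge0 ?invr_ge0 ?sqr_ge0// ltW.
Qed.

Lemma SPD_det_gt0 n (A : 'M[R]_n) : SPD A -> 0 < \det A.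
Proof.
elim: n A => [A _|n IH A pA]; first by rewrite det_mx00.
have a0 := SPD_diag ord0 pA; rewrite (@det_schur n) ?gt_eqF//.
by rewrite mulr_gt0// IH//; exact: SPD_schur.
Qed.

(** Hadamard's inequality, by induction: passing to the Schur complement
    factors out the first pivot and does not increase the diagonal. *)
Lemma SPD_det_le_prod n (A : 'M[R]_n) : SPD A -> \det A <= \prod_i A i i.
Proof.
elim: n A => [A _|n IH A pA]; first by rewrite det_mx00 big_ord0.
have a0 := SPD_diag ord0 pA; rewrite (@det_schur n) ?gt_eqF//.
rewrite big_ord_recl ler_wpM2l ?(ltW a0)//; apply: le_trans (IH _ (SPD_schur pA)) _.
apply: ler_prod => i _; rewrite ltW ?SPD_diag//=; last exact: SPD_schur.
apply: le_trans (schur_diag_le i pA) _.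
by rewrite (_ : rshift 1 i = lift ord0 i)//; exact/val_inj.
Qed.

Lemma SPD_trace_gt0 n (A : 'M[R]_n) : (0 < n)%N -> SPD A -> 0 < \tr A.
Proof.
case: n A => // n A _ pA; rewrite /mxtrace big_ord_recl.
by rewrite ltr_pwDl ?SPD_diag// sumr_ge0// => i _; rewrite ltW ?SPD_diag.
Qed.

(** AM-GM for the diagonal entries, after Hadamard's inequality. *)
Lemma SPD_det_le_trace n (A : 'M[R]_n) : SPD A ->
  \det A <= (\tr A / n%:R) ^+ n.
Proof.
move=> pA; apply: le_trans (SPD_det_le_prod pA) _.
have := @leif_AGM R 'I_n predT (fun i => A i i).
rewrite card_ord => /(_ _)[] // i _; exact/ltW/SPD_diag.
Qed.

(** Every pivot of [A] is at least [m], since the lower bound is inherited by the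
    successive Schur complements. *)
Lemma loewner_det_ge n (m : R) (A : 'M[R]_n) : 0 <= m -> SPD A ->
  loewner m%:M A -> m ^+ n <= \det A.
Proof.
move=> m0; elim: n A => [A _ _|n IH A pA mA]; first by rewrite det_mx00 expr0.
have a0 := SPD_diag ord0 pA; rewrite (@det_schur n) ?gt_eqF// exprS.
rewrite ler_pM ?exprn_ge0// ?IH//; last 2 first.
- exact: SPD_schur.
- exact: loewner_schur.
by have := mA (delta_mx ord0 ord0); rewrite -!/(qform _ _) !qform_delta mxE eqxx.
Qed.

Lemma loewner_det_le n (m : R) (A : 'M[R]_n) : SPD A ->
  loewner A m%:M -> \det A <= m ^+ n.
Proof.
move=> pA Am; apply: le_trans (SPD_det_le_prod pA) _.
rewrite -[n in leRHS]card_ord -prodr_const; apply: ler_prod => i _.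
rewrite ltW ?SPD_diag//=.
by have := Am (delta_mx i ord0); rewrite -!/(qform _ _) !qform_delta mxE eqxx.
Qed.

Lemma SPD_unit n (A : 'M[R]_n) : SPD A -> A \in unitmx.
Proof. by move=> pA; rewrite unitmxE unitfE gt_eqF// SPD_det_gt0. Qed.

Lemma qform_congr n (A P : 'M[R]_n) v : qform (P *m A *m P^T) v = qform A (P^T *m v).
Proof. by rewrite /qform trmx_mul trmxK !mulmxA. Qed.

Lemma SPD_inv n (A : 'M[R]_n) : SPD A -> SPD (invmx A).
Proof.
move=> pA; have uA := SPD_unit pA; have [sA pos] := pA.
have sV : (invmx A)^T = invmx A by rewrite trmx_inv sA.
split=> // v v0; rewrite -/(qform _ _).
have -> : invmx A = invmx A *m A *m (invmx A)^T by rewrite sV mulVmx// mul1mx.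
rewrite qform_congr; apply: pos; apply: contra_neq v0.
by rewrite sV => /(congr1 (mulmx A)); rewrite mulmx0 mulKVmx.
Qed.

Lemma SPD_congr n (A P : 'M[R]_n) : P \in unitmx -> SPD A -> SPD (P *m A *m P^T).
Proof.
move=> uP [sA pos]; split=> [|v v0]; first by rewrite !trmx_mul trmxK sA mulmxA.
rewrite -/(qform _ _) qform_congr; apply: pos; apply: contra_neq v0.
by move=> /(congr1 (mulmx (invmx P^T))); rewrite mulmx0 mulKmx// unitmx_tr.
Qed.

(** With [w = A^-1 v], expand [0 <= qform A (w - m^-1 v)] and bound the
    quadratic term by [qform A v <= m |v|^2]. *)
Lemma loewner_inv n (m : R) (A : 'M[R]_n) : 0 < m -> SPD A ->
  loewner A m%:M -> loewner m^-1%:M (invmx A).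
Proof.
move=> m0 pA Am v; rewrite -!/(qform _ _).
have uA := SPD_unit pA; have [sA pos] := pA.
have pos' u : 0 <= qform A u.
  have [->|/pos/ltW//] := eqVneq u 0.
  by rewrite /qform mulmx0 mxE.
have := pos' (invmx A *m v - m^-1 *: v); rewrite qformB//.
have -> : qform A (invmx A *m v) = qform (invmx A) v.
  by rewrite /qform trmx_mul trmx_inv sA -!mulmxA mulKVmx.
rewrite -!mulmxA mulKVmx//.
have := Am v; rewrite -!/(qform _ _) !qform_scalar.
have -> : (v^T *m v) ord0 ord0 = \sum_i v i ord0 ^+ 2.
  by rewrite mxE; apply: eq_bigr => i _; rewrite mxE expr2.
set s := \sum_i _; set x := qform (invmx A) v; set y := qform A v.
move=> ys h; have : m^-1 ^+ 2 * y <= m^-1 * s.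
  rewrite expr2 -mulrA ler_wpM2l ?invr_ge0 ?(ltW m0)//.
  by rewrite ler_pdivrMl.
lra.
Qed.

Lemma frob_sqr m n (P : 'M[R]_(m, n)) : frob P ^+ 2 = \sum_i \sum_j P i j ^+ 2.
Proof.
by rewrite sqr_sqrtr// sumr_ge0// => i _; rewrite sumr_ge0// => j _; exact: sqr_ge0.
Qed.

(** Summing [loewner_inv] over the rows of [P]. *)
Lemma frob_le_trace n (m : R) (A P : 'M[R]_n) : 0 < m -> SPD A ->
  loewner A m%:M -> frob P ^+ 2 <= m * \tr (P *m invmx A *m P^T).
Proof.
move=> m0 pA Am; rewrite frob_sqr mulr_sumr; apply: ler_sum => i _.
rewrite -qform_delta qform_congr.
have := loewner_inv m0 pA Am (P^T *m delta_mx i ord0).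
rewrite -!/(qform _ _) qform_scalar ler_pdivrMl//; apply: le_trans.
by apply: ler_sum => j _; rewrite -colE !mxE.
Qed.

End quadratic_forms.

(** * Pointwise lower bounds of the density *)

Section density_bounds.
Context (R : realType).

(** The left-hand side is minimal at [s = tau / (1 - c)]; the tangent line
    inequality [ln x <= x - 1] at [x = s (1 - c) / tau] is exactly this. *)
Lemma linear_log_ge (c tau s : R) : c < 1 -> 0 <= tau -> 0 < s ->
  - (tau * Num.max (ln (tau / (1 - c)) - 1) 0) <= (1 - c) * s - tau * ln s.
Proof.
move=> c1 tau0 s0; have c1' : 0 < 1 - c by rewrite subr_gt0.
move: tau0; rewrite le_eqVlt => /predU1P[<-|tau0].
  by rewrite !mul0r subr0 oppr0 mulr_ge0 ?(ltW c1') ?(ltW s0).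
set b := tau / (1 - c); have b0 : 0 < b by rewrite divr_gt0.
have lns : ln s = ln (s / b) + ln b.
  by rewrite -lnM ?posrE ?divr_gt0// divfK// gt_eqF.
have := @le_ln1Dx R (s / b - 1); rewrite addrCA subrr addr0 => /(_ _) h.
have {h} lnsb : ln (s / b) <= s / b - 1.
  by apply: h; rewrite ltrBrDr addNr divr_gt0.
have sb : (1 - c) * s = tau * (s / b).
  by rewrite /b; field; rewrite !gt_eqF.
have : ln b - 1 <= Num.max (ln b - 1) 0 by rewrite le_max lexx.
rewrite sb lns -mulrN -mulrBr (ler_pM2l tau0); lra.
Qed.

Lemma sqrt_exprn (m : R) n : 0 <= m -> m `^ (n%:R / 2) = Num.sqrt (m ^+ n).
Proof. by move=> m0; rewrite powRrM powR_mulrn// powR12_sqrt// exprn_ge0. Qed.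

Lemma C_const_ge0 d (p theta c : R) : 0 <= C_const d p theta c.
Proof. by rewrite !mulr_ge0 ?powR_ge0// le_max lexx orbT. Qed.

(** By AM-GM, the logarithmic term is at most [d^p theta^p ln s] with
    [s = (tr A / d)^p], which [linear_log_ge] absorbs into [(1 - c) (tr A)^p];
    then [rho] is estimated from below in front of the power of the trace and
    from above in front of the constant. *)
Lemma G_density_ge d (p theta c m0 m1 : R) (A M : 'M[R]_d) :
  (0 < d)%N -> 0 < p -> 0 < c < 1 -> 0 < m0 -> 0 < m1 -> SPD A -> SPD M ->
  loewner m0%:M M -> loewner M m1%:M ->
  c * m0 `^ (d%:R / 2) * (\tr A) `^ p - m1 `^ (d%:R / 2) * C_const d p theta c
  <= G_density p theta A (\det A) M.
Proof.
move=> d0 p0 /andP[c0 c1] m0_0 m1_0 pA pM m0M Mm1.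
have dR : 0 < d%:R :> R by rewrite ltr0n.
have S0 := SPD_trace_gt0 d0 pA.
rewrite /G_density; set S := \tr A in S0 *; set tau := theta `^ p.
have tau0 : 0 <= tau by exact: powR_ge0.
have Sd0 : 0 < S / d%:R by rewrite divr_gt0.
set s := (S / d%:R) `^ p; have s0 : 0 < s by rewrite powR_gt0.
have Sp : S `^ p = d%:R `^ p * s.
  by rewrite -powRM ?ltW// mulrC divfK// gt_eqF.
have lna : kappa d p theta * ln (\det A) <= d%:R `^ p * (tau * ln s).
  rewrite (_ : _ * (tau * ln s) = kappa d p theta * (d%:R * ln (S / d%:R))).
    rewrite ler_wpM2l//; first by rewrite !mulr_ge0 ?powR_ge0// ltW.
    rewrite mulr_natl -lnXn// ler_ln ?posrE ?SPD_det_gt0 ?exprn_gt0//.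
    exact: SPD_det_le_trace.
  rewrite /kappa ln_powR (_ : d%:R `^ p = d%:R `^ (p - 1) * d%:R).
    by rewrite -/tau; ring.
  by rewrite -{3}(powRr1 (ltW dR)) -powRD ?subrK// gt_eqF// implybT.
have dp0 : 0 < d%:R `^ p :> R by rewrite powR_gt0.
have key := linear_log_ge c1 tau0 s0.
have E : c * S `^ p - C_const d p theta c <= S `^ p - kappa d p theta * ln (\det A).
  apply: le_trans (_ : S `^ p - d%:R `^ p * (tau * ln s) <= _); last by rewrite lerB.
  rewrite Sp /C_const -/tau.
  rewrite -!mulrA mulrCA -!mulrBr ler_pM2l//; move: key; lra.
have r0 : m0 `^ (d%:R / 2) <= rho M.
  by rewrite /rho sqrt_exprn ?(ltW m0_0)// ler_wsqrtr// loewner_det_ge// ltW.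
have r1 : rho M <= m1 `^ (d%:R / 2).
  by rewrite /rho sqrt_exprn ?(ltW m1_0)// ler_wsqrtr// loewner_det_le.
apply: le_trans (_ : rho M * (c * S `^ p - C_const d p theta c) <= _); last first.
  by rewrite ler_wpM2l// sqrtr_ge0.
rewrite mulrBr lerB//; last by rewrite ler_wpM2r// C_const_ge0.
by rewrite mulrAC [leRHS]mulrC ler_wpM2l// mulr_ge0 ?powR_ge0// ltW.
Qed.

Lemma G_density_frob_ge d (p theta c m0 m1 : R) (P M : 'M[R]_d) :
  let B := P *m invmx M *m P^T in
  (0 < d)%N -> 0 < p -> 0 < c < 1 -> 0 < m0 -> 0 < m1 -> 0 < \det P -> SPD M ->
  loewner m0%:M M -> loewner M m1%:M ->
  c * m0 `^ (d%:R / 2) * m1 `^ (- p) * frob P `^ (2 * p)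
    - m1 `^ (d%:R / 2) * C_const d p theta c
  <= G_density p theta B (\det B) M.
Proof.
move=> B d0 p0 c01 m0_0 m1_0 P0 pM m0M Mm1.
have pB : SPD B.
  by apply: SPD_congr; [rewrite unitmxE unitfE gt_eqF|exact: SPD_inv].
apply: le_trans (G_density_ge theta d0 p0 c01 m0_0 m1_0 pB pM m0M Mm1).
rewrite lerB// -!mulrA !ler_wpM2l ?powR_ge0//; first by case/andP: c01 => /ltW.
rewrite powRN ler_pdivrMl ?powR_gt0// -powRM ?(ltW m1_0)//; last first.
  exact/ltW/SPD_trace_gt0.
rewrite powRrM powR_mulrn ?frob_ge0// ge0_ler_powR ?(ltW p0) ?nnegrE//.
- exact/sqr_ge0.
- by rewrite mulr_ge0 ?(ltW m1_0)// ltW// SPD_trace_gt0.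
- exact: frob_le_trace.
Qed.
End density_bounds.

(** * Borel sets and Lebesgue measure on row vectors *)

Section borel.
Context (R : realType).

Definition cube n (a : 'rV[R]_n) (r : R) : set 'rV[R]_n :=
  [set v | forall j, `|v ord0 j - a ord0 j| <= r].

Lemma measurable_cube n (a : 'rV[R]_n) r : measurable (cube a r).
Proof.
rewrite (_ : cube a r = \bigcap_(j in [set: 'I_n]) [set v | `|v ord0 j - a ord0 j| <= r]).
  apply: fin_bigcap_measurable => // j _.
  have mj : measurable_fun setT (fun v : 'rV[R]_n => v ord0 j) by exact: measurable_entry.
  have := mj measurableT [set` `[a ord0 j - r, a ord0 j + r]] (measurable_itv _).
  rewrite setTI; congr (measurable _).
  by apply/seteqP; split => v /=; rewrite in_itv/= ler_distl.
by apply/seteqP; split => [v h j _|v h j]; exact: h.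
Qed.

Lemma open_cube n (U : set 'rV[R]_n) v : open U -> U v ->
  exists2 e : R, 0 < e & cube v e `<=` U.
Proof.
move=> /[swap] Uv /(_ _) oU.
have /nbhs_ballP[e /= e0 eU] : nbhs v U by exact: open_nbhs_nbhs.
exists (e / 2); first by rewrite divr_gt0.
move=> w vw; apply: eU; split => // i j; rewrite (ord1 i) /ball/=.
rewrite distrC (le_lt_trans (vw j))// ltr_pdivrMr// mulr_natr mulr2n ltrDl//.
Qed.

(** Cubes with rational centers and radii form a countable base. *)
Lemma open_measurable_rV n (U : set 'rV[R]_n) : open U -> measurable U.
Proof.
move=> oU; pose F (qk : 'rV[rat]_n * rat) : set 'rV[R]_n :=
  if `[< cube (map_mx ratr qk.1) (ratr qk.2) `<=` U >]
  then cube (map_mx ratr qk.1) (ratr qk.2) else set0.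
have -> : U = \bigcup_qk F qk.
  apply/seteqP; split => [v Uv|v [qk _]]; last first.
    by rewrite /F; case: asboolP => // FU; exact: FU.
  have [e e0 eU] := open_cube oU Uv.
  have [k] := @rat_in_itvoo R 0 (e / 2) (divr_gt0 e0 (ltr0Sn _ 1)).
  rewrite in_itv/= => /andP[k0 ke].
  have /choice[q qv] : forall j, exists q : rat, `|v ord0 j - ratr q| <= ratr k.
    move=> j; have [q] := @rat_in_itvoo R (v ord0 j) (v ord0 j + ratr k) (ltr_pwDr k0 (lexx _)).
    rewrite in_itv/= => /andP[vq qk]; exists q.
    by rewrite ler_distlC; apply/andP; split; lra.
  have qU : cube (map_mx ratr (\row_j q j)) (ratr k) `<=` U.
    move=> w wq; apply: eU => j.
    have := wq j; have := qv j; rewrite !mxE !ler_distl => /andP[? ?] /andP[? ?].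
    by apply/andP; split; lra.
  exists (\row_j q j, k) => //; rewrite /F/=; case: asboolP => // _ j.
  by rewrite !mxE.
apply: countable_bigcupT_measurable; first exact: countableP.
by move=> qk; rewrite /F; case: asboolP => // _; exact: measurable_cube.
Qed.

Lemma continuous_measurable_rV n (f : 'rV[R]_n -> R) :
  continuous f -> measurable_fun setT f.
Proof.
move=> /continuousP cf; apply: (measurability _ (RGenOpens.measurableE R)) => _ [_ [a [b ->]] <-].
by rewrite setTI; apply: open_measurable_rV; apply: cf; exact: interval_open.
Qed.

Lemma measurable_frob d (T : measurableType d) m n (D : set T) (f : T -> 'M[R]_(m, n)) :
  measurable_fun D f -> measurable_fun D (fun x => frob (f x)).
Proof.
move=> mf.
rewrite (_ : (fun _ => _) = fun x => (\sum_i \sum_j f x i j ^+ 2) `^ 2^-1); last first.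
  apply/funext => x; rewrite powR12_sqrt// sumr_ge0// => i _.
  by rewrite sumr_ge0// => j _; exact: sqr_ge0.
apply: (@measurableT_comp _ _ _ _ _ _ (@powR R ^~ 2^-1)); first exact: measurable_powR.
apply: measurable_sum => i; apply: measurable_sum => j.
apply: measurable_funX.
exact: (measurableT_comp (measurable_entry i j) mf).
Qed.

End borel.

Section lebesgue.
Context (R : realType).

Lemma leb_borel n (A : set 'rV[R]_n) : measurable A ->
  measurable (A : set (lebesgueType R n)).
Proof.
by move=> mA; apply: sub_caratheodory; apply: sub_sigma_algebra.
Qed.

Lemma leb_borelE n (A : set 'rV[R]_n) : measurable A -> leb R n A = lebesgue_borel R n A.
Proof. exact: measurable_mu_extE. Qed.

Lemma measurable_fun_borel_leb n d (T : measurableType d) (D : set 'rV[R]_n)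
    (f : 'rV[R]_n -> T) :
  measurable D -> measurable_fun D f ->
  measurable_fun (D : set (lebesgueType R n)) (f : lebesgueType R n -> T).
Proof. by move=> mD mf _ B mB; apply: leb_borel; exact: mf. Qed.

Lemma integral_leb_borel n (f : 'rV[R]_n -> \bar R) : measurable_fun setT f ->
  (forall x, 0 <= f x)%E ->
  (\int[leb R n]_x f x = \int[lebesgue_borel R n]_x f x)%E.
Proof.
move=> mf f0; pose idl : lebesgueType R n -> 'rV[R]_n := idfun.
have mid : measurable_fun setT idl by move=> _ B mB; rewrite setTI; exact: leb_borel.
pose m1 : {measure set 'rV[R]_n -> \bar R} :=
  measure_function_pushforward__canonical__measure_function_Measure (leb R n) mid.
transitivity (\int[m1]_x f x)%E.
  by apply: esym; apply: (ge0_integral_pushforward mid (leb R n) (D:=setT)) => //.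
apply: eq_measure_integral => A mA _; exact: leb_borelE.
Qed.

Lemma integral_lebesgue_borelS n (f : 'rV[R]_n.+1 -> \bar R) : measurable_fun setT f ->
  (forall x, 0 <= f x)%E ->
  (\int[lebesgue_borel R n.+1]_x f x =
   \int[lebesgue_borel R n]_y \int[lebesgue_measure]_t f (consv (t, y)))%E.
Proof.
move=> mf f0.
transitivity (\int[(lebesgue_measure \x lebesgue_borel R n)%E]_tv f (consv tv))%E.
  exact: (ge0_integral_pushforward (@measurable_consv R n)
    (lebesgue_measure \x lebesgue_borel R n)%E (D:=setT)).
rewrite fubini_tonelli2//.
exact: measurableT_comp mf (@measurable_consv R n).
Qed.

Lemma lebesgue_borel_cube n (a : 'rV[R]_n) (r : R) : 0 <= r ->
  lebesgue_borel R n (cube a r) = ((2 * r) ^+ n)%:E.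
Proof.
move=> r0; elim: n a => [|n IH] a.
  rewrite /= diracE mem_set ?expr0//.
  by move=> [].
pose a' : 'rV[R]_n := \row_j a ord0 (@rshift 1 n j).
rewrite -[LHS]/((lebesgue_measure \x lebesgue_borel R n)%E (@consv R n @^-1` cube a r)).
have -> : @consv R n @^-1` cube a r = [set` `[a ord0 ord0 - r, a ord0 ord0 + r]] `*` cube a' r.
  apply/seteqP; split => -[t y] /=.
    move=> h; split => /=.
      have := h (@lshift 1 n ord0); rewrite (@row_mxEl _ 1 1 n) mxE/= in_itv/= -ler_distl.
      by congr (`|_ - a _ _| <= _); exact/val_inj.
    by move=> j; have := h (@rshift 1 n j); rewrite (@row_mxEr _ 1 1 n) mxE.
  move=> [/= h1 h2] j; case: (@split_ordP 1 n j) => k ->.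
    rewrite (@row_mxEl _ 1 1 n) mxE/=; move: h1; rewrite in_itv/= -ler_distl.
    by rewrite (ord1 k) (_ : lshift n ord0 = ord0)//; exact/val_inj.
  by rewrite (@row_mxEr _ 1 1 n); have := h2 k; rewrite mxE.
rewrite product_measure1E//; last exact: measurable_cube.
rewrite IH exprS EFinM; congr (_ * _)%E.
rewrite [LHS](lebesgue_measure_itv `[a ord0 ord0 - r, a ord0 ord0 + r])/= lte_fin; case: ifPn => h.
  by rewrite -EFinB; congr EFin; ring.
move: h; rewrite -leNgt => h; congr EFin; lra.
Qed.

End lebesgue.

(** * Caratheodory's criterion *)

Section caratheodory_criterion.
Context (R : realType) (T : Type) (mu : {outer_measure set T -> \bar R}) (f : T -> R).
Local Open Scope ereal_scope.

Hypothesis mu_sep : forall (a b : R) (A B : set T), (a < b)%R ->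
  (forall x, A x -> (f x <= a)%R) -> (forall x, B x -> (b <= f x)%R) ->
  mu A + mu B <= mu (A `|` B).

(** The layers [layer k], at distance about 1/k from the level [c], have summable
    measures: [sub k] and [layer k] are separated subsets of [sub k.+2], so the
    sum telescopes. Hence [sub n] exhausts the strict sublevel set in measure. *)
Lemma sublevel_caratheodory (c : R) : mu.-caratheodory [set x | (f x < c)%R].
Proof.
apply: le_caratheodory_measurable => X.
have [->|Xoo] := eqVneq (mu X) +oo; first exact: leey.
pose a n : R := (c - n.+1%:R^-1)%R.
have ac n : (a n < c)%R by rewrite /a ltrBlDr ltrDl invr_gt0.
have alt n : (a n < a n.+1)%R by rewrite /a ltrD2l ltrN2 ltf_pV2 ?posrE// ltr_nat.
pose sub n := X `&` [set x | (f x <= a n)%R].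
pose layer n := X `&` [set x | (a n.+1 < f x <= a n.+2)%R].
have le_sum n : \sum_(0 <= k < n) mu (layer k) <= mu (sub n) + mu (sub n.+1).
  elim: n => [|n IH]; first by rewrite big_geq// adde_ge0 ?outer_measure_ge0.
  rewrite big_nat_recr//= (le_trans (leeD2r _ IH))// addeAC [leRHS]addeC leeD2r//.
  apply: le_trans (mu_sep (A := sub n) (B := layer n) (alt n) _ _) _.
  - by move=> x [].
  - by move=> x [_ /andP[/ltW]].
  apply: le_outer_measure => x [[Xx /= fx]|[Xx /= /andP[_ fx]]]; split => //=.
  by rewrite (le_trans fx)// ltW// (lt_trans (alt n)).
have layer_oo : \sum_(0 <= k <oo) mu (layer k) < +oo.
  apply: (@le_lt_trans _ _ (mu X + mu X)); last by rewrite lte_add_pinfty// ltey.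
  apply: lime_le; first by apply: is_cvg_nneseries => *; exact: outer_measure_ge0.
  apply: nearW => n; apply: le_trans (le_sum n) _.
  by apply: leeD; apply: le_outer_measure => x [].
have := nneseries_tail_cvg layer_oo (fun _ _ => outer_measure_ge0 _ _).
move=> /fine_cvgP[tail_fin /cvgrPdist_le tail0].
apply/lee_addgt0Pr => e e0.
have [N _ /(_ N (leqnn N)) hN] : \forall n \near \oo,
    \sum_(n <= k <oo) mu (layer k) <= e%:E.
  near=> n.
  have : \sum_(n <= k <oo) mu (layer k) \is a fin_num by near: n.
  move=> /fineK <-; rewrite lee_fin.
  have : (`|0 - (fine \o (fun N => \sum_(N <= k <oo) mu (layer k))) n| <= e)%R.
    by near: n; exact: tail0.
  by rewrite sub0r normrN; exact/le_trans/ler_norm.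
apply: (@le_trans _ _ ((mu (sub N.+1) + mu (X `&` ~` [set x | (f x < c)%R])) +
    \sum_(N <= k <oo) mu (layer k))).
  rewrite addeAC leeD2r//.
  apply: le_trans (leeD2l _ (outer_measure_sigma_subadditive_tail mu N layer)).
  apply: le_trans (outer_measureU2 _ _ _); apply: le_outer_measure => x [Xx /= fxc].
  have [k fxk] : exists k, (f x <= a k)%R.
    exists (Num.truncn (c - f x)^-1); rewrite /a lerBrDr -lerBrDl invf_ple ?posrE ?subr_gt0//.
    exact/ltW/truncnS_gt.
  have [xN|xN] := leP (f x) (a N.+1); [by left|right].
  (* If [j] is the first index with [f x <= a j], then [x] is in layer [j - 2]. *)
  have exk : exists k, (f x <= a k)%R by exists k.
  case: (ex_minnP exk) => j fxj jmin.
  have aN m : (m <= N.+1)%N -> (a m <= a N.+1)%R.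
    by move=> mN; rewrite lerD2l lerN2 lef_pV2 ?posrE// ler_nat.
  have Nj : (N.+1 < j)%N.
    by rewrite ltnNge; apply/negP => /aN /(le_trans fxj); rewrite leNgt xN.
  exists j.-2; first by apply/negP; rewrite -leqNgt; case: (j) Nj => [|[]].
  case: j Nj fxj jmin => [|[|j]]// Nj fxj jmin; split => //=; rewrite fxj andbT ltNge.
  by apply/negP => /jmin; rewrite ltnn.
apply: leeD hN; apply: le_trans (mu_sep (ac N.+1) _ _) _.
- by move=> x [].
- by move=> x [_ /= /negP]; rewrite -leNgt.
- by apply: le_outer_measure => x [[]|[]].
Unshelve. all: by end_near. Qed.
End caratheodory_criterion.

(** * Borel sets are measurable for the Hausdorff measure *)

Section frobenius.
Context (R : realType).

Lemma entry_le_frob m n (A : 'M[R]_(m, n)) i j : `|A i j| <= frob A.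
Proof.
rewrite -sqrtr_sqr ler_wsqrtr// (bigD1 i)//= (bigD1 j)//=.
rewrite -addrA lerDl addr_ge0 ?sumr_ge0// => [l _|l _]; first exact: sqr_ge0.
by rewrite sumr_ge0// => ? _; exact: sqr_ge0.
Qed.

Lemma frob_le_entries m n (A : 'M[R]_(m, n)) (C : R) : 0 <= C ->
  (forall i j, `|A i j| <= C) -> frob A <= (m * n)%:R * C.
Proof.
move=> C0 AC; rewrite -[leRHS]ger0_norm ?mulr_ge0// -sqrtr_sqr ler_wsqrtr//.
apply: (@le_trans _ _ (\sum_(i < m) \sum_(j < n) C ^+ 2)).
  apply: ler_sum => i _; apply: ler_sum => j _.
  by rewrite -real_normK ?num_real// ler_pXn2r ?nnegrE.
rewrite !sumr_const !card_ord -mulrnA mulnC exprMn -[leLHS]mulr_natl ler_wpM2r ?sqr_ge0//.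
by rewrite -natrX ler_nat; case: (m * n)%N => // l; exact: leq_pmulr.
Qed.
End frobenius.

Section hausdorff_borel.
Context (R : realType) (n k : nat).
Local Open Scope ereal_scope.

Lemma diam_ge (U : set 'rV[R]_n) x y : U x -> U y -> (frob (x - y)%R)%:E <= diam U.
Proof. by move=> Ux Uy; apply: ereal_sup_ubound; exists x => //; exists y. Qed.

Lemma hausdorff_gauge_anti (d1 d2 : R) (U : set 'rV[R]_n) : (d1 <= d2)%R ->
  @hausdorff_gauge R n k d2 U <= @hausdorff_gauge R n k d1 U.
Proof.
move=> d12; rewrite /hausdorff_gauge; case: ifPn => // _.
case: ifPn => [h2|h2]; case: ifPn => [h1|h1]; rewrite ?leey//.
by rewrite (le_trans h1) ?lee_fin in h2.
Qed.

Lemma hausdorff_pre_anti (d1 d2 : R) (A : set 'rV[R]_n) : (d1 <= d2)%R ->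
  hausdorff_pre k d2 A <= hausdorff_pre k d1 A.
Proof.
move=> d12; apply: le_ereal_inf_tmp => _ [F FA <-].
apply: (@le_trans _ _ (\sum_(j <oo) @hausdorff_gauge R n k d2 (F j))).
  by apply: ereal_inf_lbound; exists F.
apply: lee_nneseries => j _; first by move=> _; exact: hausdorff_gauge_ge0.
exact: hausdorff_gauge_anti.
Qed.

(** A set of diameter at most [delta < b - a] meets only one of two sets whose
    [i]-th coordinates are separated by [b - a], so a cover of the union splits
    into covers of the two sets. *)
Lemma hausdorff_pre_sep (i : 'I_n) (a b delta : R) (A B : set 'rV[R]_n) :
  (delta < b - a)%R ->
  (forall x, A x -> (x ord0 i <= a)%R) -> (forall x, B x -> (b <= x ord0 i)%R) ->
  hausdorff_pre k delta A + hausdorff_pre k delta B <= hausdorff_pre k delta (A `|` B).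
Proof.
move=> ab Aa Bb; apply: le_ereal_inf_tmp => _ [F [_ ABF] <-].
pose pick (C : set 'rV[R]_n) j := if `[< exists x, F j x /\ C x >] then F j else set0.
have pre_pick C : C `<=` A `|` B -> hausdorff_pre k delta C <=
    \sum_(j <oo) @hausdorff_gauge R n k delta (pick C j).
  move=> CAB; apply: ereal_inf_lbound; exists (pick C) => //; split => // x Cx.
  have [j _ Fjx] := ABF _ (CAB _ Cx); exists j => //; rewrite /pick.
  by case: asboolP => //; case; exists x.
have g0 := @hausdorff_gauge_ge0 R n k delta.
apply: le_trans (leeD (pre_pick A _) (pre_pick B _)) _.
- by move=> x; left.
- by move=> x; right.
rewrite -nneseriesD//; apply: lee_nneseries => j _; first by move=> _; rewrite adde_ge0.
rewrite /pick; case: asboolP => [[x [Fx Ax]]|_]; case: asboolP => [[y [Fy By]]|_];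
  rewrite ?hausdorff_gauge0 ?adde0 ?add0e//.
rewrite [leRHS]/hausdorff_gauge ifF; last by apply/negP => /eqP F0; rewrite F0 in Fx.
case: ifPn => [dF|_]; last by rewrite leey.
have := le_trans (diam_ge Fy Fx) dF; rewrite lee_fin => yx.
have := entry_le_frob (y - x)%R ord0 i; rewrite !mxE => yxi.
have := le_trans (ler_norm _) (le_trans yxi yx) => yx_delta.
by exfalso; have := Aa _ Ax; have := Bb _ By; lra.
Qed.

Lemma hausdorff_sep (i : 'I_n) (a b : R) (A B : set 'rV[R]_n) : (a < b)%R ->
  (forall x, A x -> (x ord0 i <= a)%R) -> (forall x, B x -> (b <= x ord0 i)%R) ->
  hausdorff R n k A + hausdorff R n k B <= hausdorff R n k (A `|` B).
Proof.
move=> ab Aa Bb; set z := hausdorff R n k (A `|` B).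
have [->|zoo] := eqVneq z +oo; first exact: leey.
have fin (x : \bar R) : 0 <= x -> x <= z -> x \is a fin_num.
  by move=> x0 xz; rewrite ge0_fin_numE// (le_lt_trans xz)// ltey.
have pre_ge0 delta C : 0 <= @hausdorff_pre R n k delta C.
  exact/mu_ext_ge0/hausdorff_gauge_ge0.
have key (d1 d2 : R) : (0 < d1)%R -> (0 < d2)%R ->
    hausdorff_pre k d1 A + hausdorff_pre k d2 B <= z.
  move=> d10 d20; pose delta : R := Num.min (Num.min d1 d2) ((b - a) / 2)%R.
  have delta0 : (0 < delta)%R by rewrite !lt_min d10 d20 divr_gt0 ?subr_gt0.
  apply: le_trans (hausdorff_pre_le _ _ delta0).
  apply: le_trans (hausdorff_pre_sep (i := i) _ Aa Bb).
    by apply: leeD; apply: hausdorff_pre_anti; rewrite /delta !ge_min lexx ?orbT.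
  rewrite (@le_lt_trans _ _ ((b - a) / 2)%R)//; first by rewrite ge_min lexx orbT.
  by rewrite ltr_pdivrMr// mulr_natr mulr2n ltrDl subr_gt0.
have HA : hausdorff R n k A <= z by apply: le_outer_measure; exact: subsetUl.
have HB : hausdorff R n k B <= z by apply: le_outer_measure; exact: subsetUr.
rewrite -leeBrDr; last exact/fin/HB/outer_measure_ge0.
apply: ge_ereal_sup => _ [d1 /= d10 <-].
rewrite leeBrDr; last exact/fin/HB/outer_measure_ge0.
have finA : hausdorff_pre k d1 A \is a fin_num.
  exact/fin/(le_trans (hausdorff_pre_le _ _ d10) HA)/pre_ge0.
rewrite -leeBrDl//; apply: ge_ereal_sup => _ [d2 /= d20 <-].
by rewrite leeBrDl// key.
Qed.

Lemma hausdorff_borel (A : set 'rV[R]_n) : measurable A ->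
  (hausdorff R n k).-caratheodory A.
Proof.
pose T := caratheodory_type (hausdorff R n k).
suff mcoord i : measurable_fun (setT : set T) (fun x : T => (x : 'rV[R]_n) ord0 i).
  move: A; apply: smallest_sub; first exact: (@sigma_algebra_measurable _ T).
  move=> _ [i [j [B [mB ->]]]]; rewrite (ord1 i).
  by have := mcoord j measurableT B mB; rewrite setTI.
apply: (measurability _ (RGenCInfty.measurableE R)) => _ [_ [c ->] <-].
rewrite setTI (_ : _ @^-1` _ = ~` [set x : T | (x : 'rV[R]_n) ord0 i < c])%R.
  apply: measurableC; apply: sublevel_caratheodory => a b B C ab Ba Cb.
  exact: (hausdorff_sep ab Ba Cb).
by apply/seteqP; split=> x /=; rewrite in_itv/= andbT leNgt => /negP.
Qed.

End hausdorff_borel.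

(** * Projections and Hausdorff measure *)

Section hausdorff_projection.
Context (R : realType) (k : nat).
Local Open Scope ereal_scope.

Lemma ball_volume_gt0 : (0 < ball_volume R k)%R.
Proof.
rewrite /ball_volume divr_gt0 ?exprn_gt0// fine_gt0//; apply/andP; split.
  pose r : R := (k.+1%:R^-1)%R; have r0 : (0 < r)%R by rewrite invr_gt0.
  apply: (@lt_le_trans _ _ (leb R k (cube 0 r))).
    rewrite leb_borelE; last exact: measurable_cube.
    by rewrite lebesgue_borel_cube ?(ltW r0)// lte_fin exprn_gt0// mulr_gt0.
  apply: le_outer_measure => v /= vr.
  apply: le_trans (frob_le_entries (ltW r0) _) _.
    by move=> i j; rewrite (ord1 i); have := vr j; rewrite mxE subr0.
  by rewrite mul1n ler_pdivrMr// mul1r ler_nat.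
apply: (@le_lt_trans _ _ (leb R k (cube 0 1))).
  apply: le_outer_measure => v /= vr j; rewrite mxE subr0.
  exact: le_trans (entry_le_frob _ _ _) vr.
rewrite leb_borelE; last exact: measurable_cube.
by rewrite lebesgue_borel_cube// ltry.
Qed.

Definition tail (x : 'rV[R]_k.+1) : 'rV[R]_k := \row_j x ord0 (rshift 1 j).

Lemma tail_consv t y : tail (consv (t, y)) = y.
Proof. by apply/rowP => j; rewrite mxE (@row_mxEr _ 1 1 k). Qed.

Let C : R := (2 ^+ k / ball_volume R k)%R.

Let C_gt0 : (0 < C)%R.
Proof. by rewrite divr_gt0 ?exprn_gt0// ball_volume_gt0. Qed.

(** A set of finite gauge projects into a cube whose half side is its diameter.
    The constant [C] is the ratio of the volumes of this cube and of the ball in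
    the gauge. *)
Lemma gauge_projection (F : set 'rV[R]_k.+1) : exists B : set 'rV[R]_k,
  [/\ measurable B, tail @` F `<=` B &
      lebesgue_borel R k B <= C%:E * @hausdorff_gauge R k.+1 k 1%R F].
Proof.
have [F0|/set0P[x Fx]] := eqVneq F set0.
  exists set0; split => //; first by rewrite F0 image_set0.
  by rewrite measure0 mule_ge0 ?lee_fin ?(ltW C_gt0)// hausdorff_gauge_ge0.
have [dF|dF] := leP (diam F) 1%:E; last first.
  exists setT; split => //; rewrite /hausdorff_gauge ifF.
    by rewrite ifN -?ltNge// gt0_muley ?leey// lte_fin.
  by apply/negP => /eqP F0; rewrite F0 in Fx.
have diam0 : 0 <= diam F.
  by apply: le_trans (diam_ge Fx Fx); rewrite lee_fin frob_ge0.
have dfin : diam F \is a fin_num by rewrite ge0_fin_numE// (le_lt_trans dF)// ltry.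
set r := fine (diam F); have rE : diam F = r%:E by rewrite fineK.
have r0 : (0 <= r)%R by rewrite fine_ge0.
exists (cube (tail x) r); split; first exact: measurable_cube.
  move=> _ [y Fy <-] j; rewrite !mxE.
  have := entry_le_frob (y - x)%R ord0 (rshift 1 j); rewrite !mxE => /le_trans; apply.
  by rewrite -lee_fin -rE; exact: diam_ge.
rewrite lebesgue_borel_cube// /hausdorff_gauge ifF; last first.
  by apply/negP => /eqP F0; rewrite F0 in Fx.
rewrite dF rE -EFin_expe -!EFinM lee_fin /C exprMn.
by rewrite mulrA divfK// gt_eqF// ball_volume_gt0.
Qed.

Lemma hausdorff_projection_approx (E : set 'rV[R]_k.+1) (e : R) : (0 < e)%R ->
  hausdorff R k.+1 k E < +oo ->
  exists B : set 'rV[R]_k, [/\ measurable B, tail @` E `<=` B &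
    lebesgue_borel R k B <= C%:E * (hausdorff R k.+1 k E + e%:E)].
Proof.
move=> e0 Eoo; have pre1 := @hausdorff_pre_le R k.+1 k 1%R E ltr01.
have pre_fin : hausdorff_pre k 1%R E \is a fin_num.
  rewrite ge0_fin_numE ?(le_lt_trans pre1)//.
  exact/mu_ext_ge0/hausdorff_gauge_ge0.
have [_ [F [_ EF] <-] Fe] := lb_ereal_inf_adherent e0 pre_fin.
have /choice[B BF] := fun j => gauge_projection (F j).
have mB j : measurable (B j) by case: (BF j).
exists (\bigcup_j B j); split; first exact: bigcupT_measurable.
  move=> _ [x Ex <-]; have [j _ Fjx] := EF _ Ex; exists j => //.
  by have [_ + _] := BF j; apply; exists x.
have g0 j : 0 <= @hausdorff_gauge R k.+1 k 1%R (F j) by exact: hausdorff_gauge_ge0.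
apply: (@le_trans _ _ (\sum_(j <oo) lebesgue_borel R k (B j))).
  by apply: measure_sigma_subadditive => //; exact: bigcupT_measurable.
apply: (@le_trans _ _ (\sum_(j <oo) C%:E * @hausdorff_gauge R k.+1 k 1%R (F j))).
  by apply: lee_nneseries => j _ //; case: (BF j).
rewrite nneseriesZl// lee_pmul2l ?lte_fin//.
by apply: le_trans (ltW Fe) _; rewrite leeD2r.
Qed.

(** The hull [B] is an intersection of unions of cubes coming from coverings of
    [E] that are nearly optimal for the Hausdorff measure. A hull is needed
    because the projection of a Borel set need not be a Borel set. *)
Lemma hausdorff_projection : exists2 C : R, (0 < C)%R &
  forall E : set 'rV[R]_k.+1, exists B : set 'rV[R]_k,
    [/\ measurable B, tail @` E `<=` B &
        lebesgue_borel R k B <= C%:E * hausdorff R k.+1 k E].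
Proof.
exists C => // E; have [Eoo|Eoo] := leP +oo (hausdorff R k.+1 k E).
  exists setT; split => //.
  by move: Eoo; rewrite leye_eq => /eqP ->; rewrite gt0_muley ?leey// lte_fin.
have inv0 j : (0 < j.+1%:R^-1 :> R)%R by rewrite invr_gt0.
have /choice[B BE] := fun j => hausdorff_projection_approx (inv0 j) Eoo.
have mB j : measurable (B j) by case: (BE j).
exists (\bigcap_j B j); split; first exact: bigcapT_measurable.
  by move=> y Ey j _; have [_ + _] := BE j; apply.
have Efin : hausdorff R k.+1 k E \is a fin_num by rewrite ge0_fin_numE// outer_measure_ge0.
apply/lee_addgt0Pr => e e0.
have [N Ne] : exists N, (C * N.+1%:R^-1 <= e)%R.
  exists (Num.truncn (C / e)); rewrite ler_pdivrMr// -ler_pdivrMl// mulrC.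
  exact/ltW/truncnS_gt.
apply: (@le_trans _ _ (lebesgue_borel R k (B N))).
  by apply: le_measure; rewrite ?inE//; [exact: bigcapT_measurable|exact: bigcap_inf].
have [_ _ /le_trans] := BE N; apply.
by rewrite muleDr ?fin_num_adde_defl// leeD2l// -EFinM lee_fin.
Qed.

End hausdorff_projection.

(** * One-variable and measure-theoretic inequalities *)

Section one_variable.
Context (R : realType).

Lemma powRD_le (q a b : R) : 0 <= q -> 0 <= a -> 0 <= b ->
  (a + b) `^ q <= 2 `^ q * (a `^ q + b `^ q).
Proof.
move=> q0; wlog ab : a b / a <= b => [h a0 b0|a0 b0].
  have [/h|/ltW /h] := leP a b; first exact.
  by rewrite addrC [_ `^ q + _]addrC; exact.
apply: (@le_trans _ _ ((2 * b) `^ q)).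
  by rewrite ge0_ler_powR ?nnegrE ?addr_ge0 ?mulr_ge0// mulr_natl mulr2n lerD2r.
by rewrite powRM// ler_wpM2l ?powR_ge0// lerDr powR_ge0.
Qed.

Lemma first_exit (S : set R) (L t : R) : open S -> S `<=` [set u | u <= L] -> S t ->
  exists s, [/\ t < s, ~ S s & forall u, t <= u < s -> S u].
Proof.
move=> oS SL St; pose X := [set u | t <= u /\ ~ S u].
have X0 : X !=set0.
  exists (L + 1); split; first by rewrite (le_trans (SL _ St))// lerDl.
  by move=> /SL /=; rewrite leNgt ltrDl ltr01.
have lX : lbound X t by move=> u [].
have hX : has_inf X by split=> //; exists t.
pose s := inf X; have ts : t <= s by exact: lb_le_inf.
have Ss : ~ S s.
  move=> Ss; have /nbhs_ballP[e /= e0 eS] : nbhs s S by exact: open_nbhs_nbhs.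
  have [u [tu Su] ue] := inf_adherent e0 hX.
  apply: (Su); apply: eS; rewrite /ball/= distrC ger0_norm ?subr_ge0.
    by rewrite ltrBlDl.
  by apply: ge_inf; [exists t|split].
exists s; split => //.
  by rewrite lt_neqAle ts andbT; apply/eqP => ts'; apply: Ss; rewrite -ts'.
move=> u /andP[tu us]; apply: contrapT => Su.
by move: us; rewrite ltNge => /negP; apply; apply: ge_inf; [exists t|split].
Qed.

(** The interval is half open because [s] will be an exit point, which does not
    belong to the slice. *)
Lemma FTC_abs (f f' : R -> R) (t s : R) : t < s ->
  (forall x : R, is_derive x (1 : R) f (f' x)) -> continuous f' ->
  (`|f t|%:E <= `|f s|%:E + \int[lebesgue_measure]_(u in `[t, s[) `|f' u|%:E)%E.
Proof.
move=> ts df cf'.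
have cf : continuous f by move=> x; apply: differentiable_continuous; apply/derivable1_diffP.
have cf'w : {within `[t, s], continuous f'} by exact: continuous_subspaceT.
have Fd : derivable_oo_LRcontinuous f t s.
  split; first by move=> x _; exact: ex_derive.
  - by apply: cvg_at_right_filter; exact: cf.
  - by apply: cvg_at_left_filter; exact: cf.
have f'E : {in `]t, s[, derive1 f =1 f'} by move=> x _; rewrite derive1E derive_val.
have FTC := continuous_FTC2 ts cf'w Fd f'E.
have intf' : (lebesgue_measure.-integrable `[t, s] (EFin \o f'))%E.
  by apply: continuous_compact_integrable => //; exact: segment_compact.
have : (`|(f s)%:E - (f t)%:E| <= \int[lebesgue_measure]_(u in `[t, s]) `|f' u|%:E)%E.
  rewrite -FTC; apply: le_trans (le_abse_integral _ _ _) _ => //.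
  by case/integrableP: intf'.
rewrite -integral_itv_bndo_bndc; last first.
  apply/measurable_EFinP; apply: measurableT_comp => //.
  by apply: measurable_funTS; exact: continuous_measurable_fun.
move=> h; rewrite -leeBlDl//; apply: le_trans h.
by rewrite -EFinB lee_fin distrC lerB_dist.
Qed.

End one_variable.

Section jensen.
Context d (T : measurableType d) (R : realType) (mu : {measure set T -> \bar R}).
Local Open Scope ereal_scope.

(** Hoelder's inequality for [a] and the indicator of [D]. *)
Lemma jensen_powR (D : set T) (a : T -> R) (l q : R) : measurable D ->
  mu D <= l%:E -> (1 < q)%R -> measurable_fun setT a -> (forall x, 0 <= a x)%R ->
  (\int[mu]_(x in D) (a x)%:E) `^ q <=
  (l `^ (q - 1))%:E * \int[mu]_(x in D) (a x `^ q)%:E.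
Proof.
move=> mD Dl q1 ma a0; have q0 : (0 < q)%R by rewrite (lt_trans ltr01).
pose f := fun x => (a x * \1_D x)%R.
have mf : measurable_fun setT f by apply: measurable_funM => //; exact: measurable_indic.
pose q' := (q / (q - 1))%R; have q10 : (0 < q - 1)%R by rewrite subr_gt0.
have q'0 : (0 < q')%R by rewrite divr_gt0.
have qq' : (q^-1 + q'^-1 = 1)%R.
  by rewrite /q' invf_div; field; rewrite gt_eqF.
have := hoelder mu mf (measurable_indic mD : measurable_fun setT (\1_D : T -> R)) q0 q'0 qq'.
have l0 : (0 <= l)%R by rewrite -lee_fin (le_trans _ Dl).
rewrite Lnorm1.
have -> : \int[mu]_x `|((f \* \1_D)%R x)%:E| = \int[mu]_(x in D) (a x)%:E.
  rewrite [RHS]integral_mkcond; apply: eq_integral => x _.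
  rewrite /f patchE /= indicE; case: (x \in D) => /=.
    by rewrite !mulr1 ger0_norm.
  by rewrite !mulr0 normr0.
move=> h; have : (\int[mu]_(x in D) (a x)%:E) `^ q <=
    (Lnorm mu q%:E (EFin \o f) * Lnorm mu q'%:E (EFin \o \1_D)) `^ q.
  apply: gt0_ler_poweR => //; first exact: ltW.
  - by rewrite in_itv/= leey andbT integral_ge0// => x _; rewrite lee_fin.
  - by rewrite in_itv/= leey andbT mule_ge0// Lnorm_ge0.
move=> /le_trans; apply; rewrite poweRM ?Lnorm_ge0// muleC.
apply: lee_pmul; rewrite ?poweR_ge0//.
  rewrite [in leLHS]unlock /=.
  have -> : \int[mu]_x `|(\1_D x)%:E| `^ q' = mu D.
    rewrite -[in RHS](setIT D) -integral_indic//; apply: eq_integral => x _.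
    rewrite indicE; case: (x \in D) => /=; first by rewrite normr1 powR1.
    by rewrite normr0 powR0 // gt_eqF.
  rewrite -poweRrM (_ : q'^-1 * q = q - 1)%R; last first.
    by rewrite /q' invf_div divfK// gt_eqF.
  rewrite -poweR_EFin; apply: gt0_ler_poweR => //; first exact: ltW.
  - by rewrite in_itv/= leey andbT.
  - by rewrite in_itv/= leey andbT lee_fin.
rewrite powR_Lnorm ?gt_eqF// [leRHS]integral_mkcond le_eqVlt; apply/orP; left.
apply/eqP; apply: eq_integral => x _; rewrite /f patchE /= indicE.
case: (x \in D) => /=; first by rewrite mulr1 ger0_norm.
by rewrite mulr0 normr0 powR0// gt_eqF.
Qed.

End jensen.

Section dyadic.
Context (R : realType).
Implicit Types (h : R) (n : nat).

Let step h j : R := if 2 ^+ j < h then 2 ^+ j else 0.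

Let step_ge0 h j : 0 <= step h j.
Proof. by rewrite /step; case: ifPn. Qed.

Lemma dyadic_ge h n : Num.min h (2 ^+ n) <= 1 + \sum_(0 <= j < n) step h j.
Proof.
elim: n => [|n IH]; first by rewrite big_geq// addr0 expr0 ge_min lexx orbT.
rewrite big_nat_recr//= {2}/step; case: ifPn => hn.
  rewrite addrA ge_min; apply/orP; right; rewrite exprS mulr_natl mulr2n lerD2r.
  by move: IH; rewrite min_r// ltW.
rewrite addr0; apply: le_trans IH; rewrite -leNgt in hn.
by rewrite [leRHS]min_l// ge_min lexx.
Qed.

Lemma dyadic_le h n : 0 <= h ->
  \sum_(0 <= j < n) step h j <= Num.min (2 ^+ n) (2 * h).
Proof.
move=> h0; elim: n => [|n IH].
  by rewrite big_geq// le_min expr0 ler01 mulr_ge0.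
rewrite big_nat_recr//= {2}/step; move: IH; rewrite !le_min => /andP[IH1 IH2].
case: ifPn => hn; last first.
  rewrite addr0 IH2 andbT (le_trans IH1)// exprS mulr_natl mulr2n lerDl.
  exact: exprn_ge0.
rewrite exprS !mulr_natl !mulr2n lerD2r IH1/=.
by apply: lerD; [exact/ltW/(le_lt_trans IH1)|exact: ltW].
Qed.

(** Layer cake decomposition along the powers of 2; only levels above 1 are
    used, hence the additive constant. *)
Lemma dyadic_upper h : (h%:E <= 1 + \sum_(0 <= j <oo) (step h j)%:E)%E.
Proof.
pose n := Num.truncn h; have hn : h <= 2 ^+ n.+1.
  have [h0|h0] := leP h 0; first by rewrite (le_trans h0)// exprn_ge0.
  rewrite ltW// (lt_le_trans (truncnS_gt h))// -natrX ler_nat.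
  by rewrite ltnW// ltn_expl.
apply: (@le_trans _ _ (1 + \sum_(0 <= j < n.+1) (step h j)%:E)%E).
  by rewrite sumEFin -EFinD lee_fin; have := dyadic_ge h n.+1; rewrite min_l.
rewrite leeD2l//; apply: nneseries_lim_ge => j *; rewrite lee_fin; exact: step_ge0.
Qed.

Lemma dyadic_lower h : 0 <= h -> (\sum_(0 <= j <oo) (step h j)%:E <= (2 * h)%:E)%E.
Proof.
move=> h0; apply: lime_le.
  by apply: is_cvg_nneseries => j _ _; rewrite lee_fin step_ge0.
apply: nearW => n; rewrite sumEFin lee_fin.
by have := dyadic_le n h0; rewrite le_min => /andP[].
Qed.
End dyadic.

(** * Slices in the first coordinate direction *)

Section slices.
Context (R : realType) (n : nat).
Implicit Types (t : R) (y : 'rV[R]_n).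

Lemma consvE t y : consv (t, y) = consv (0, y) + t *: delta_mx ord0 ord0.
Proof.
apply/rowP => j; rewrite [RHS]mxE [X in _ + X]mxE [X in _ * X]mxE eqxx /= /consv.
case: (@split_ordP 1 n j) => k ->.
  have -> : (lshift n k == ord0 :> 'I_n.+1) by apply/eqP/val_inj; rewrite (ord1 k).
  by rewrite !(@row_mxEl _ 1 1 n) !mxE add0r mulr1.
by rewrite !(@row_mxEr _ 1 1 n) (_ : rshift 1 k == ord0 = false) ?mulr0 ?addr0.
Qed.

Lemma continuous_consv y : continuous (fun t => consv (t, y)).
Proof.
move=> t; rewrite (_ : (fun t => _) = fun t : R => consv (0, y) + t *: delta_mx ord0 ord0).
  by apply: cvgD; [exact: cvg_cst|apply: cvgZr_tmp; exact: cvg_id].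
by apply/funext => u; exact: consvE.
Qed.

Lemma is_derive_consv (f : 'rV[R]_n.+1 -> R) y t :
  (forall x, differentiable f x) ->
  is_derive t (1 : R) (fun u => f (consv (u, y))) (partial ord0 f (consv (t, y))).
Proof.
move=> df; set v : 'rV[R]_n.+1 := delta_mx ord0 ord0.
have E : (fun h : R => h^-1 *: (((fun u => f (consv (u, y))) \o shift t) (h *: 1) -
      f (consv (t, y)))) =
    (fun h : R => h^-1 *: ((f \o shift (consv (t, y))) (h *: v) - f (consv (t, y)))).
  apply/funext => h /=; congr (_ *: (f _ - _)).
  rewrite [LHS]consvE (consvE t) scalerDl addrCA.
  by congr (_ + (_ + _)); rewrite /GRing.scale/= mulr1.
have dfv := diff_derivable (df (consv (t, y))) : derivable f (consv (t, y)) v.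
split.
  by rewrite /derivable E.
by rewrite /derive E.
Qed.

Lemma smooth_differentiable (f : 'rV[R]_n -> R) x : smooth f -> differentiable f x.
Proof. by move=> sf; exact: (sf [::]). Qed.

Lemma smooth_continuous (f : 'rV[R]_n -> R) : smooth f -> continuous f.
Proof. by move=> sf x; apply: differentiable_continuous; exact: smooth_differentiable. Qed.

Lemma smooth_partial_continuous (f : 'rV[R]_n -> R) j : smooth f -> continuous (partial j f).
Proof. by move=> sf x; apply: differentiable_continuous; exact: (sf [:: j]). Qed.

End slices.

Section trace_inequality_slice.
Context (R : realType) (n : nat) (Omega : set 'rV[R]_n.+1) (L : R).
Hypothesis oOmega : open Omega.
Hypothesis OmegaL : Omega `<=` cube 0 L.

Definition slice (y : 'rV[R]_n) : set R := [set t | Omega (consv (t, y))].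

Lemma consv_cube (t : R) (y : 'rV[R]_n) : cube 0 L (consv (t, y)) -> `|t| <= L /\ cube 0 L y.
Proof.
move=> c; split.
  by have := c (@lshift 1 n ord0); rewrite (@row_mxEl _ 1 1 n) !mxE subr0.
by move=> j; have := c (@rshift 1 n j); rewrite (@row_mxEr _ 1 1 n) !mxE.
Qed.

Lemma open_slice y : open (slice y).
Proof. by have /continuousP := @continuous_consv R n y; apply. Qed.

Lemma slice_bounded y : slice y `<=` [set` `[- L, L]].
Proof. by move=> t /OmegaL/consv_cube[+ _]; rewrite /= in_itv/= ler_norml. Qed.

Variable phi : 'rV[R]_n.+1 -> 'rV[R]_n.+1.
Hypothesis sphi : forall i, smooth (fun x => phi x ord0 i).

Lemma measurable_smooth : measurable_fun setT phi.
Proof.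
apply: measurable_fun_mx => i j; rewrite (ord1 i).
by apply: continuous_measurable_rV; apply: smooth_continuous; exact: sphi.
Qed.

Lemma measurable_jacobian : measurable_fun setT (Defs.jacobian phi).
Proof.
apply: measurable_fun_mx => i j.
rewrite (_ : (fun _ => _) = partial j (fun y => phi y ord0 i)).
  by apply: continuous_measurable_rV; apply: smooth_partial_continuous; exact: sphi.
by apply/funext => x; rewrite mxE.
Qed.

(** The point is moved in the first coordinate direction until its first exit
    from the domain, which is a boundary point; up to there the segment stays in
    the slice, so the derivative along it is controlled by the slice integral. *)
Lemma slice_exit_bound y t : slice y t -> exists2 s, bdry Omega (consv (s, y)) &
  ((frob (phi (consv (t, y))))%:E <= n.+1%:R%:E * ((frob (phi (consv (s, y))))%:E +
     \int[lebesgue_measure]_(u in slice y) (frob (Defs.jacobian phi (consv (u, y))))%:E))%E.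
Proof.
move=> St; have SL : slice y `<=` [set u | u <= L].
  by move=> u /slice_bounded/=; rewrite in_itv/= => /andP[].
have [s [ts Ss tsS]] := first_exit (@open_slice y) SL St.
exists s.
  split; last by move=> /interior_subset/Ss.
  move=> V /(@continuous_consv R n y s)/nbhs_ballP[e /= e0 eV].
  pose u := Num.max t (s - e / 2).
  exists (consv (u, y)); split; last first.
    apply: eV; rewrite /ball/= ger0_norm ?subr_ge0.
      rewrite ltrBlDr -ltrBlDl lt_max; apply/orP; right.
      by rewrite ltrD2l ltrN2 ltr_pdivrMr// mulr_natr mulr2n ltrDl.
    by rewrite ge_max ltW//= lerBlDr lerDl divr_ge0 ?ltW.
  apply: tsS; rewrite le_max lexx/= gt_max ts/= ltrBlDr ltrDl divr_gt0//.
set z := (\int[_]_(_ in _) _)%E.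
have z0 : (0 <= z)%E by apply: integral_ge0 => u _; rewrite lee_fin frob_ge0.
have mslice : measurable (slice y) by apply: open_measurable; exact: open_slice.
have mjac : measurable_fun setT (fun u => frob (Defs.jacobian phi (consv (u, y)))).
  apply: measurable_frob; apply: (measurableT_comp measurable_jacobian).
  by apply: (measurableT_comp (@measurable_consv R n)); exact: measurable_pair2.
have [->|zoo] := eqVneq z +oo%E.
  by rewrite addey// gt0_muley ?leey// lte_fin.
have zfin : z \is a fin_num by rewrite ge0_fin_numE// ltey.
rewrite -(fineK zfin) -EFinD -EFinM lee_fin.
apply: le_trans (frob_le_entries (C := frob (phi (consv (s, y))) + fine z) _ _) _.
- by rewrite addr_ge0 ?frob_ge0 ?fine_ge0.
- move=> i j; rewrite (ord1 i) -lee_fin EFinD fineK//.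
  have cf' : continuous (fun u => partial ord0 (fun x => phi x ord0 j) (consv (u, y))).
    move=> u; apply: continuous_comp; first exact: continuous_consv.
    by apply: smooth_partial_continuous; exact: sphi.
  have df (u : R) : is_derive u (1 : R) (fun v => phi (consv (v, y)) ord0 j)
      (partial ord0 (fun x => phi x ord0 j) (consv (u, y))).
    apply: (is_derive_consv (f := fun x => phi x ord0 j)) => x.
    by apply: smooth_differentiable; exact: sphi.
  apply: le_trans (FTC_abs ts df cf') _.
  apply: leeD; first by rewrite lee_fin entry_le_frob.
  apply: (@le_trans _ _ (\int[lebesgue_measure]_(u in `[t, s[)
      (frob (Defs.jacobian phi (consv (u, y))))%:E)%E).
    apply: ge0_le_integral => //.
    + apply/measurable_EFinP; apply: measurable_funTS; apply: measurableT_comp => //.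
      exact: continuous_measurable_fun.
    + by apply/measurable_EFinP; apply: measurable_funTS.
    + move=> u _; rewrite lee_fin.
      by have := entry_le_frob (Defs.jacobian phi (consv (u, y))) j ord0; rewrite mxE.
  apply: ge0_subset_integral => //.
  + by apply/measurable_EFinP; apply: measurable_funTS.
  + by move=> u _; rewrite lee_fin frob_ge0.
- by rewrite mul1n.
Qed.
End trace_inequality_slice.

(** * A Poincare inequality for smooth functions *)

Section fubini_slices.
Context (R : realType) (n : nat) (Omega : set 'rV[R]_n.+1) (f : 'rV[R]_n.+1 -> R).
Hypothesis mOmega : measurable Omega.
Hypothesis mf : measurable_fun setT f.
Hypothesis f0 : forall x, 0 <= f x.
Local Open Scope ereal_scope.

Let fO : 'rV[R]_n.+1 -> \bar R := (fun x => (f x)%:E) \_ Omega.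

Let mfO : measurable_fun setT fO.
Proof.
apply/(measurable_restrictT _ mOmega); apply: measurable_funTS.
exact/measurable_EFinP.
Qed.

Let fO_ge0 x : 0 <= fO x.
Proof. by apply: erestrict_ge0 => ? _; rewrite lee_fin. Qed.

Let slice_patch y : \int[lebesgue_measure]_(t in slice Omega y) (f (consv (t, y)))%:E =
  \int[lebesgue_measure]_t fO (consv (t, y)).
Proof.
rewrite integral_mkcond; apply: eq_integral => t _; rewrite /fO !patchE.
by [].
Qed.

Lemma integral_slices : \int[leb R n.+1]_(x in Omega) (f x)%:E =
  \int[lebesgue_borel R n]_y \int[lebesgue_measure]_(t in slice Omega y) (f (consv (t, y)))%:E.
Proof.
rewrite integral_mkcond integral_leb_borel// integral_lebesgue_borelS//.
by apply: eq_integral => y _; rewrite slice_patch.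
Qed.

Lemma measurable_integral_slice : measurable_fun setT
  (fun y => \int[lebesgue_measure]_(t in slice Omega y) (f (consv (t, y)))%:E).
Proof.
rewrite (_ : (fun _ => _) = fubini_G lebesgue_measure (fO \o @consv R n)).
  apply: measurable_fun_fubini_tonelli_G => [|[t y]]; last exact: fO_ge0.
  exact: measurableT_comp mfO (@measurable_consv R n).
by apply/funext => y; rewrite slice_patch.
Qed.

Lemma integral_slices_le (L : R) (G : 'rV[R]_n -> \bar R) : Omega `<=` cube 0 L ->
  measurable_fun setT G -> (forall y, 0 <= G y) ->
  (forall y, \int[lebesgue_measure]_(t in slice Omega y) (f (consv (t, y)))%:E <= G y) ->
  \int[leb R n.+1]_(x in Omega) (f x)%:E <=
  \int[lebesgue_borel R n]_(y in cube 0 L) G y.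
Proof.
move=> OmegaL mG G0 fG.
have mcube : measurable (cube (0 : 'rV[R]_n) L) by exact: measurable_cube.
rewrite integral_slices [leRHS]integral_mkcond; apply: ge0_le_integral.
- exact: measurableT.
- by move=> y _; apply: integral_ge0 => t _; rewrite lee_fin.
- exact: measurable_integral_slice.
- by apply/(measurable_restrictT _ mcube); exact: measurable_funTS.
move=> y _; rewrite patchE; case: ifPn => [_|]; first exact: fG.
rewrite notin_setE => yL; rewrite (_ : slice Omega y = set0) ?integral_set0//.
by apply/seteqP; split => // t /OmegaL/consv_cube[].
Qed.

End fubini_slices.

Section dyadic_integral.
Context d (T : measurableType d) (R : realType) (mu : {measure set T -> \bar R}).
Local Open Scope ereal_scope.

(** The counterpart of [dyadic_majorant]: summing over the dyadic levels costs
    only a factor 2. *)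
Lemma dyadic_integral (D : set T) (h : T -> R) :
  measurable D -> measurable_fun D h -> (forall x, 0 <= h x)%R ->
  (forall j, measurable (D `&` [set x | (2 ^+ j < h x)%R])) ->
  \sum_(0 <= j <oo) (2 ^+ j)%:E * mu (D `&` [set x | (2 ^+ j < h x)%R]) <=
  2%:E * \int[mu]_(x in D) (h x)%:E.
Proof.
move=> mD mh h0 mlevel; pose level j := D `&` [set x | (2 ^+ j < h x)%R].
pose step j (x : T) : \bar R := ((2 ^+ j)%:E * (\1_(level j) x)%:E)%E.
have mstep j : measurable_fun D (step j).
  apply: emeasurable_funM => //; apply/measurable_EFinP.
  by apply: measurable_funTS; apply: measurable_indic; exact: mlevel.
have step0 j x : 0 <= step j x by rewrite mule_ge0// lee_fin exprn_ge0.
rewrite (_ : \sum_(0 <= j <oo) _ =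
    \sum_(0 <= j <oo) \int[mu]_(x in D) step j x); last first.
  apply: eq_eseriesr => j _.
  rewrite ge0_integralZl//.
    by rewrite (integral_indic _ mD (mlevel j)) setIAC setIid.
  by apply/measurable_EFinP/measurable_funTS; apply: measurable_indic; exact: mlevel.
rewrite -integral_nneseries//.
rewrite -ge0_integralZl//; last 2 first.
  exact/measurable_EFinP.
  by move=> x _; rewrite lee_fin.
apply: ge0_le_integral => //.
- by move=> x _; exact: nneseries_ge0.
- by apply: ge0_emeasurable_sum => // j _; exact: mstep.
- by apply: emeasurable_funM => //; exact/measurable_EFinP.
move=> x Dx; apply: le_trans (dyadic_lower (h0 x)); rewrite le_eqVlt; apply/orP; left.
apply/eqP; apply: eq_eseriesr => j _; rewrite /step indicE.
case: ifPn => hx; first by rewrite mem_set ?mule1.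
by rewrite memNset ?mule0// => -[_ /=]; rewrite (negbTE hx).
Qed.
End dyadic_integral.

Section bounded_integral.
Context d (T : measurableType d) (R : realType) (mu : {measure set T -> \bar R}).
Local Open Scope ereal_scope.

Lemma integral_le_cst (D : set T) (f : T -> R) (c l : R) :
  measurable D -> mu D <= l%:E -> measurable_fun setT f -> (forall x, 0 <= f x)%R ->
  (0 <= c)%R -> (forall x, D x -> (f x)%:E <= c%:E) ->
  \int[mu]_(x in D) (f x)%:E <= (l * c)%:E.
Proof.
move=> mD Dl mf f0 c0 fc; apply: (@le_trans _ _ (\int[mu]_(x in D) c%:E)).
  apply: ge0_le_integral => //.
  - by move=> x _; rewrite lee_fin.
  - by apply/measurable_EFinP; exact: measurable_funTS.
by rewrite integral_cst// mulrC EFinM lee_wpmul2l.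
Qed.
End bounded_integral.

Section dyadic_majorant.
Context d (T : measurableType d) (R : realType) (mu : {measure set T -> \bar R}).
Local Open Scope ereal_scope.
Variables (D : set T) (B : nat -> set T) (v : T -> \bar R) (k a e : R).
Hypothesis mD : measurable D.
Hypothesis Da : mu D <= a%:E.
Hypothesis mB : forall j, measurable (B j).
Hypothesis mv : measurable_fun setT v.
Hypothesis v0 : forall x, 0 <= v x.
Hypothesis k0 : (0 <= k)%R.
Hypothesis e0 : (0 <= e)%R.

Let step j (y : T) : \bar R := (2 ^+ j)%:E * (\1_(B j) y)%:E.

(** When [B j] contains the projection of the set where a function exceeds
    [2^j], this bounds the supremum of that function over the fibre above [y],
    see [dyadic_majorant_ge]. *)
Definition dyadic_majorant y := 1 + \sum_(0 <= j <oo) step j y.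

Let step0 j y : 0 <= step j y.
Proof. by rewrite /step -EFinM lee_fin mulr_ge0 ?exprn_ge0. Qed.

Let mstep j : measurable_fun setT (step j).
Proof. by apply: emeasurable_funM => //; apply/measurable_EFinP; apply: measurable_indic. Qed.

Lemma dyadic_majorant_ge0 y : 0 <= dyadic_majorant y.
Proof. by rewrite adde_ge0// nneseries_ge0. Qed.

Lemma measurable_dyadic_majorant : measurable_fun setT dyadic_majorant.
Proof.
by apply: emeasurable_funD => //; apply: ge0_emeasurable_sum => // j _; exact: mstep.
Qed.

Lemma dyadic_majorant_ge (h : R) y :
  (forall j, (2 ^+ j < h)%R -> B j y) -> h%:E <= dyadic_majorant y.
Proof.
move=> hB; apply: le_trans (dyadic_upper _) _; rewrite leeD2l//.
apply: lee_nneseries => j _.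
  by move=> _; rewrite lee_fin; case: ifPn => // _; exact: exprn_ge0.
case: ifPn => hj; last exact: step0.
by rewrite /step indicE mem_set ?mule1//; exact: hB.
Qed.

Lemma measurable_majorant :
  measurable_fun setT (fun y => k%:E * (dyadic_majorant y + e%:E * v y)).
Proof.
apply: emeasurable_funM => //; apply: emeasurable_funD.
  exact: measurable_dyadic_majorant.
exact: emeasurable_funM.
Qed.

Lemma majorant_ge0 y : 0 <= dyadic_majorant y + e%:E * v y.
Proof. by rewrite adde_ge0 ?dyadic_majorant_ge0// mule_ge0. Qed.

Lemma integral_dyadic_majorant :
  \int[mu]_(y in D) (k%:E * (dyadic_majorant y + e%:E * v y)) <=
  k%:E * (a%:E + \sum_(0 <= j <oo) (2 ^+ j)%:E * mu (B j) + e%:E * \int[mu]_y v y).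
Proof.
have mTS (f : T -> \bar R) : measurable_fun setT f -> measurable_fun D f.
  exact: measurable_funTS.
have mev : measurable_fun D (fun y => e%:E * v y).
  by apply: mTS; exact: emeasurable_funM.
rewrite ge0_integralZl//; last 2 first.
- apply: emeasurable_funD => //; apply: mTS; exact: measurable_dyadic_majorant.
- by move=> y _; exact: majorant_ge0.
rewrite lee_wpmul2l//.
rewrite ge0_integralD//; last 3 first.
- by move=> y _; exact: dyadic_majorant_ge0.
- by apply: mTS; exact: measurable_dyadic_majorant.
- by move=> y _; rewrite mule_ge0.
apply: leeD.
  rewrite ge0_integralD//; last 2 first.
  - by move=> y _; exact: nneseries_ge0.
  - by apply: ge0_emeasurable_sum => // j _; exact: mTS.
  apply: leeD; first by rewrite integral_cst// mul1e.
  rewrite integral_nneseries//; last by move=> j; exact: mTS.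
  apply: lee_nneseries => j _; first by move=> _; apply: integral_ge0.
  rewrite ge0_integralZl//; last first.
    by apply: mTS; apply/measurable_EFinP; exact: measurable_indic.
  rewrite lee_wpmul2l ?lee_fin ?exprn_ge0// integral_indic//.
  by apply: le_measure; rewrite ?inE//; exact: measurableI.
rewrite ge0_integralZl//; last exact: mTS.
by rewrite lee_wpmul2l//; exact: ge0_subset_integral.
Qed.

End dyadic_majorant.

Section smooth_poincare.
Context (R : realType) (n : nat) (Omega : set 'rV[R]_n.+1) (L q : R).
Hypothesis oOmega : open Omega.
Hypothesis OmegaL : Omega `<=` cube 0 L.
Hypothesis L0 : 0 < L.
Hypothesis q1 : 1 < q.
Local Open Scope ereal_scope.

Let q0 : (0 < q)%R. Proof. exact: lt_trans q1. Qed.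

Let mOmega : measurable Omega. Proof. exact: open_measurable_rV. Qed.

Lemma measurable_bdry : measurable (bdry Omega).
Proof.
apply: measurableD; last first.
  by apply: open_measurable_rV; exact: open_interior.
have oC : open (~` closure Omega) by apply: closed_openC; exact: closed_closure.
by rewrite -[closure _]setCK; apply: measurableC; exact: open_measurable_rV.
Qed.

Let surf_bdry : measurable (bdry Omega : set (surfaceType R n.+1)).
Proof. apply: hausdorff_borel; exact: measurable_bdry. Qed.

Section function.
Variable phi : 'rV[R]_n.+1 -> 'rV[R]_n.+1.
Hypothesis sphi : forall i, smooth (fun x => phi x ord0 i).

Let h x : R := (frob (phi x) `^ q)%R.
Let w x : R := (frob (Defs.jacobian phi x) `^ q)%R.

Let h0 x : (0 <= h x)%R. Proof. exact: powR_ge0. Qed.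
Let w0 x : (0 <= w x)%R. Proof. exact: powR_ge0. Qed.

Let mh : measurable_fun setT h.
Proof.
apply: (measurableT_comp (measurable_powR q)); apply: measurable_frob.
exact: measurable_smooth.
Qed.

Let mw : measurable_fun setT w.
Proof.
apply: (measurableT_comp (measurable_powR q)); apply: measurable_frob.
exact: measurable_jacobian.
Qed.

Let level j : set 'rV[R]_n.+1 := bdry Omega `&` [set x | (2 ^+ j < h x)%R].

Let level_measurable j : measurable (level j : set (surfaceType R n.+1)).
Proof.
apply: hausdorff_borel; apply: measurableI; first exact: measurable_bdry.
have := mh measurableT (measurable_itv (`](2 ^+ j : R), +oo[)%R); rewrite setTI.
by congr (measurable _); apply/seteqP; split => x /=; rewrite in_itv/= andbT.
Qed.

Let sum_levels :
  \sum_(0 <= j <oo) (2 ^+ j)%:E * surf R n.+1 (level j) <=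
  2%:E * \int[surf R n.+1]_(x in bdry Omega) (h x)%:E.
Proof.
apply: (dyadic_integral (surf R n.+1) surf_bdry _ h0 level_measurable).
move=> _ B mB; apply: measurableI => //; apply: hausdorff_borel.
by rewrite -[X in measurable X]setTI; exact: mh.
Qed.

Let K1 : R := (n.+1%:R `^ q * 2 `^ q)%R.
Let ell : R := ((2 * L) `^ (q - 1))%R.

Let K1_gt0 : (0 < K1)%R. Proof. by rewrite mulr_gt0 ?powR_gt0. Qed.
Let ell_gt0 : (0 < ell)%R. Proof. by rewrite powR_gt0// mulr_gt0. Qed.

Let slice_measurable y : measurable (slice Omega y).
Proof. by apply: open_measurable; exact: open_slice. Qed.

Let slice_measure y : lebesgue_measure (slice Omega y) <= (2 * L)%:E.
Proof.
apply: (@le_trans _ _ (lebesgue_measure [set` `[(- L)%R, L]])).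
  apply: le_measure; rewrite ?inE; [exact: slice_measurable|by []|].
  exact: (slice_bounded OmegaL).
by rewrite lebesgue_measure_itv/= lte_fin gtrN// -EFinB lee_fin opprK mulr_natl mulr2n.
Qed.

Let w_slice y := \int[lebesgue_measure]_(t in slice Omega y) (w (consv (t, y)))%:E.

Let w_slice_ge0 y : 0 <= w_slice y.
Proof. by apply: integral_ge0 => t _; rewrite lee_fin. Qed.

Let measurable_line (f : 'rV[R]_n.+1 -> R) y : measurable_fun setT f ->
  measurable_fun setT (fun t : measurableTypeR R => f (consv (t, y))).
Proof.
move=> mf; apply: (measurableT_comp mf).
by apply: (measurableT_comp (@measurable_consv R n)); exact: measurable_pair2.
Qed.

(** The q-th power of [slice_exit_bound], with Jensen's inequality for the
    integral over the slice, whose length is at most [2 L]. *)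
Let slice_pointwise y t : slice Omega y t -> exists2 s, bdry Omega (consv (s, y)) &
  (h (consv (t, y)))%:E <= K1%:E * ((h (consv (s, y)))%:E + ell%:E * w_slice y).
Proof.
move=> St; have [s bs le_s] := slice_exit_bound oOmega OmegaL sphi St.
exists s => //; have [->|woo] := eqVneq (w_slice y) +oo.
  by rewrite gt0_muley ?lte_fin// addey// gt0_muley ?leey// lte_fin.
set z := (\int[_]_(_ in _) _) in le_s.
have z0 : 0 <= z by apply: integral_ge0 => u _; rewrite lee_fin frob_ge0.
have mjac : measurable_fun setT
    (fun u : measurableTypeR R => frob (Defs.jacobian phi (consv (u, y)))).
  apply: (measurable_line (f := fun x => frob (Defs.jacobian phi x))).
  by apply: measurable_frob; exact: measurable_jacobian.
have zw : z `^ q <= ell%:E * w_slice y.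
  apply: (jensen_powR (mu := @lebesgue_measure R) (slice_measurable y)
    (slice_measure y) q1 mjac) => u.
  exact: frob_ge0.
have wfin : w_slice y \is a fin_num by rewrite ge0_fin_numE// ltey.
have zfin : z \is a fin_num.
  rewrite ge0_fin_numE//; apply: (@lty_poweRy _ _ q); first by rewrite gt_eqF.
  by apply: le_lt_trans zw _; rewrite -(fineK wfin) -EFinM ltry.
move: le_s zw; rewrite -(fineK zfin) -(fineK wfin) -!EFinM !lee_fin => le_s zw.
have z0' : (0 <= fine z)%R by rewrite fine_ge0.
apply: (@le_trans _ _ ((n.+1%:R * (frob (phi (consv (s, y))) + fine z)) `^ q)%R).
  by rewrite ge0_ler_powR ?(ltW q0) ?nnegrE ?frob_ge0// mulr_ge0// addr_ge0// frob_ge0.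
rewrite powRM ?addr_ge0 ?frob_ge0// /K1 -mulrA ler_wpM2l ?powR_ge0//.
apply: le_trans (powRD_le (ltW q0) (frob_ge0 _) z0') _.
by rewrite ler_wpM2l ?powR_ge0// lerD2l.
Qed.

(** Tonelli's theorem for the bound of [slice_pointwise]: the values at the exit
    points are bounded by a dyadic majorant that depends only on the projection
    [y]. The hypothesis on [C] is [hausdorff_projection]. *)
Lemma smooth_poincare_const (C : R) : (0 < C)%R ->
  (forall E : set 'rV[R]_n.+1, exists B : set 'rV[R]_n,
    [/\ measurable B, @tail R n @` E `<=` B &
        lebesgue_borel R n B <= C%:E * hausdorff R n.+1 n E]) ->
  \int[leb R n.+1]_(x in Omega) (h x)%:E <=
  (2 * L * K1)%:E * (((2 * L) ^+ n)%:E +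
    C%:E * (2%:E * \int[surf R n.+1]_(x in bdry Omega) (h x)%:E) +
    ell%:E * \int[leb R n.+1]_(x in Omega) (w x)%:E).
Proof.
move=> C0 /(_ _)/cid-/all_tag[hull hullP].
pose B j := hull (level j).
have mB j : measurable (B j) by case: (hullP (level j)).
have levelB j x : level j x -> B j (tail x).
  by move=> xj; case: (hullP (level j)) => _ + _; apply; exists x.
have BH j : lebesgue_borel R n (B j) <= C%:E * surf R n.+1 (level j).
  by case: (hullP (level j)).
pose maj := dyadic_majorant R B.
have h_maj s y : bdry Omega (consv (s, y)) -> (h (consv (s, y)))%:E <= maj y.
  move=> bs; apply: dyadic_majorant_ge => j hj.
  by rewrite -(tail_consv s y); apply: levelB.
have mw_slice : measurable_fun setT w_slice by exact: measurable_integral_slice.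
have k0 : (0 <= 2 * L * K1)%R by rewrite !mulr_ge0 ?(ltW L0) ?(ltW K1_gt0).
have ell0 := ltW ell_gt0.
have slice_int y : \int[lebesgue_measure]_(t in slice Omega y) (h (consv (t, y)))%:E <=
    (2 * L * K1)%:E * (maj y + ell%:E * w_slice y).
  have brk0 : 0 <= maj y + ell%:E * w_slice y by exact: majorant_ge0.
  have := slice_pointwise (y := y); move: brk0 (h_maj ^~ y).
  rewrite -/(maj y); set m := maj y; set z := ell%:E * w_slice y => brk0 hm hp.
  have [bnd_oo|bnd_oo] := eqVneq (m + z) +oo.
    by rewrite bnd_oo gt0_muley ?leey// lte_fin !mulr_gt0.
  have fin : m + z \is a fin_num by rewrite ge0_fin_numE ?ltey.
  rewrite -(fineK fin) -EFinM -[(2 * L * K1 * _)%R]mulrA.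
  apply: (integral_le_cst (mu := @lebesgue_measure R) (slice_measurable y) (slice_measure y)).
  - exact: measurable_line.
  - by move=> t; exact: h0.
  - by rewrite mulr_ge0 ?(ltW K1_gt0)// fine_ge0.
  move=> t St; have [s bs hs] := hp t St.
  apply: le_trans hs _; rewrite [leRHS]EFinM fineK// lee_pmul2l ?lte_fin//.
  by rewrite leeD2r// hm.
have cube_measure : lebesgue_borel R n (cube 0 L) <= ((2 * L) ^+ n)%:E.
  by rewrite lebesgue_borel_cube// ltW.
apply: le_trans (integral_slices_le mOmega mh h0 OmegaL _ _ slice_int) _.
- exact: measurable_majorant.
- by move=> y; apply: mule_ge0 => //; exact: majorant_ge0.
apply: le_trans (integral_dyadic_majorant (measurable_cube _ _) cube_measure mB
  mw_slice w_slice_ge0 k0 ell0) _.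
rewrite lee_wpmul2l// [in leRHS](integral_slices mOmega mw w0) leeD2r// leeD2l//.
apply: le_trans (lee_wpmul2l _ sum_levels); last by rewrite lee_fin ltW.
rewrite -nneseriesZl; last by move=> j _; rewrite mule_ge0// lee_fin exprn_ge0.
apply: lee_nneseries => j _; first by move=> _; rewrite mule_ge0// lee_fin exprn_ge0.
rewrite [leRHS]muleCA; apply: lee_wpmul2l; last exact: BH.
by rewrite lee_fin exprn_ge0.
Qed.

End function.
End smooth_poincare.

(** * Lower integrals and powers of norms *)

Section lower_integral.
Context d (T : measurableType d) (R : realType) (mu : {measure set T -> \bar R}).
Local Open Scope ereal_scope.

(** The integral of a nonnegative function is defined as a supremum over simple
    functions below it, hence it is monotone even without measurability. *)
Lemma le_lower_integral (f g : T -> \bar R) :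
  (forall x, 0 <= f x) -> (forall x, f x <= g x) -> \int[mu]_x f x <= \int[mu]_x g x.
Proof.
move=> f0 fg; have g0 x : 0 <= g x by exact: le_trans (fg x).
rewrite !ge0_integralTE//; apply: ge_ereal_sup => _ [h hf <-].
by apply: ereal_sup_ubound; exists h => // x; exact: le_trans (fg x).
Qed.

(** As [W] may be nonmeasurable, its positive part is bounded from below and its
    negative part from above by measurable functions, modified on the null set
    [N] so that the bounds hold everywhere. The constant [b] is paid once for
    each part. *)
Lemma ae_integral_ge (D : set T) (W : T -> \bar R) (F : T -> R) (b : R) :
  measurable D -> mu D < +oo -> measurable_fun D F -> (forall x, 0 <= F x)%R ->
  (0 <= b)%R -> {ae mu, forall x, D x -> (F x - b)%:E <= W x} ->
  \int[mu]_(x in D) (F x)%:E - 2%:E * (b%:E * mu D) <= \int[mu]_(x in D) W x.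
Proof.
move=> mD Doo mF F0 b0 [N [mN N0 NW]].
have WN x : D x -> ~ N x -> (F x - b)%:E <= W x.
  move=> Dx nNx; apply: contrapT => h; apply: nNx; apply: NW => /=.
  by move=> /(_ Dx).
have mDN : measurable (D `\` N) by exact: measurableD.
have Dfin : mu D \is a fin_num by rewrite ge0_fin_numE.
have bD : b%:E * mu D \is a fin_num by rewrite fin_numM.
have DN_le : mu (D `\` N) <= mu D by apply: le_measure; rewrite ?inE//; exact: subDsetl.
pose F1 x := (Num.max (F x - b) 0)%R.
have F10 x : (0 <= F1 x)%R by rewrite le_max lexx orbT.
have mF1 : measurable_fun (D `\` N) F1.
  apply: measurable_maxr => //; apply: measurable_funB => //.
  exact: measurable_funS mF.
have pos : \int[mu]_(x in D) (F x)%:E - b%:E * mu D <= \int[mu]_(x in D) W^\+ x.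
  rewrite leeBlDr// (ge0_negligible_integral _ _ _ _ N0)//; last 2 first.
  - exact/measurable_EFinP.
  - by move=> x _; rewrite lee_fin.
  apply: (@le_trans _ _ (\int[mu]_(x in D `\` N) ((F1 x)%:E + b%:E))).
    apply: ge0_le_integral => //.
    - by move=> x _; rewrite lee_fin.
    - by apply/measurable_EFinP; exact: measurable_funS mF.
    - by apply: emeasurable_funD => //; exact/measurable_EFinP.
    by move=> x _; rewrite -EFinD lee_fin -lerBlDr le_max lexx.
  rewrite ge0_integralD//; last 2 first.
  - by move=> x _; rewrite lee_fin.
  - exact/measurable_EFinP.
  apply: leeD; last by rewrite integral_cst// lee_wpmul2l ?lee_fin.
  rewrite integral_mkcond [leRHS]integral_mkcond; apply: le_lower_integral => x.
    by apply: erestrict_ge0 => y _; rewrite lee_fin.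
  rewrite !patchE; case: ifPn => [|_].
    rewrite inE => -[Dx nNx]; rewrite mem_set// /F1 EFin_max funeposE.
    by rewrite ge_max !le_max lexx orbT andbT WN.
  by case: ifP => // _; exact: funepos_ge0.
have neg : \int[mu]_(x in D) W^\- x <= b%:E * mu D.
  pose U := (fun x => b%:E + (cst +oo \_ N : T -> \bar R) x).
  have N_ge0 x : 0 <= (cst +oo \_ N : T -> \bar R) x.
    by rewrite patchE; case: ifP => _ /=; rewrite ?le0y.
  have mNoo : measurable_fun D (cst +oo \_ N : T -> \bar R).
    apply: measurable_funTS; apply/(measurable_restrictT _ mN).
    exact: measurable_cst.
  apply: (@le_trans _ _ (\int[mu]_(x in D) U x)).
    rewrite integral_mkcond [leRHS]integral_mkcond; apply: le_lower_integral => x.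
      exact: erestrict_ge0.
    rewrite !patchE; case: ifPn => // /[!inE] Dx; rewrite /U patchE.
    case: ifPn => [_|]; first by rewrite addey// leey.
    rewrite notin_setE => nNx.
    rewrite adde0 funenegE ge_max lee_fin b0 andbT leeNl.
    by apply: le_trans (WN x Dx nNx); rewrite lee_fin lerDr.
  rewrite ge0_integralD// integral_cst//.
  rewrite (ge0_negligible_integral _ _ _ _ N0)//.
  rewrite integral0_eq ?adde0// => x [_ nNx].
  by rewrite patchE memNset.
rewrite [leRHS]integralE; apply: le_trans (leeB pos neg).
rewrite -[leRHS]addeA leeD2l// (_ : 2%:E = 1%:E + 1%:E :> \bar R); last by rewrite -EFinD.
by rewrite ge0_muleDl// mul1e fin_num_oppeD.
Qed.

End lower_integral.

Section power_triangle.
Context d (T : measurableType d) (R : realType) (mu : {measure set T -> \bar R}).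
Local Open Scope ereal_scope.

(** A triangle inequality up to a dimensional constant, obtained entrywise. *)
Lemma frob_sub_le m n (A B : 'M[R]_(m, n)) :
  (frob A <= (m * n)%:R * (frob (B - A)%R + frob B))%R.
Proof.
apply: frob_le_entries => [|i j]; first by rewrite addr_ge0 ?frob_ge0.
have := entry_le_frob (B - A)%R i j; have := entry_le_frob B i j; rewrite !mxE.
have := ler_normB (B i j) (B i j - A i j)%R; rewrite subKr; lra.
Qed.

Lemma power_triangle m n (D : set T) (q : R) (F G : T -> 'M[R]_(m, n)) :
  measurable D -> (0 <= q)%R -> measurable_fun D F -> measurable_fun D G ->
  \int[mu]_(x in D) (frob (F x) `^ q)%:E <=
  ((m * n)%:R `^ q * 2 `^ q)%:E *
    (\int[mu]_(x in D) (frob (G x - F x)%R `^ q)%:E +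
     \int[mu]_(x in D) (frob (G x) `^ q)%:E).
Proof.
move=> mD q0 mF mG.
have mpow m' n' (H : T -> 'M[R]_(m', n')) : measurable_fun D H ->
    measurable_fun D (fun x => (frob (H x) `^ q)%:E).
  move=> mH; apply/measurable_EFinP; apply: (measurableT_comp (measurable_powR q)).
  exact: measurable_frob.
have mGF : measurable_fun D (fun x => G x - F x)%R.
  apply: measurable_fun_mx => i j.
  rewrite (_ : (fun _ => _) = fun x => G x i j - F x i j)%R.
    by apply: measurable_funB; apply: (measurableT_comp (measurable_entry i j)).
  by apply/funext => x; rewrite !mxE.
have pow0 x : 0 <= (x `^ q)%:E by rewrite lee_fin powR_ge0.
rewrite -ge0_integralD//; [|exact: mpow|exact: mpow].
rewrite -ge0_integralZl//; last 2 first.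
- by apply: emeasurable_funD; exact: mpow.
- by move=> x _; rewrite adde_ge0.
apply: ge0_le_integral => //; first exact: mpow.
  by apply: emeasurable_funM => //; apply: emeasurable_funD; exact: mpow.
move=> x _; rewrite -EFinD -EFinM lee_fin.
apply: le_trans (ge0_ler_powR q0 _ _ (frob_sub_le (F x) (G x))) _; rewrite ?nnegrE ?frob_ge0//.
  by rewrite mulr_ge0// addr_ge0 ?frob_ge0.
rewrite powRM ?addr_ge0 ?frob_ge0// -mulrA ler_wpM2l ?powR_ge0//.
by apply: powRD_le; rewrite ?frob_ge0.
Qed.

End power_triangle.

(** * A Poincare inequality with trace *)

Section auxiliary.
Context (R : realType).

Lemma frob_subC m n (A B : 'M[R]_(m, n)) : frob (A - B) = frob (B - A).
Proof.
rewrite /frob; congr (Num.sqrt _); apply: eq_bigr => i _; apply: eq_bigr => j _.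
by rewrite !mxE -sqrrN opprB.
Qed.

Local Open Scope ereal_scope.

(** Here [S], [B] and [J] stand for the norms of a smooth function on the domain,
    of its restriction to the boundary and of its Jacobian, and [G] and [Y] for
    those of the limits of the last two. *)
Lemma chain_bound (k0 c1 c2 : R) (S B J G Y : \bar R) :
  (0 <= k0)%R -> (0 <= c1)%R -> (0 <= c2)%R -> 0 <= Y -> 0 <= G ->
  S <= k0%:E * (1 + B + J) -> B <= c1%:E * (1 + G) -> J <= c2%:E * (1 + Y) ->
  c1%:E * (1 + S) <= (c1 * (1 + k0 * (1 + c1 + c2)))%:E * (1 + G + Y).
Proof.
move=> k00 c10 c20 Y0 G0 SBJ BG JY; set M := 1 + G + Y.
have M1 : 1 <= M by rewrite /M -addeA leeDl// adde_ge0.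
have M0 : 0 <= M by exact: le_trans M1.
have GM : 1 + G <= M by rewrite leeDl.
have YM : 1 + Y <= M by rewrite /M addeAC leeDl.
have BM : B <= c1%:E * M by apply: le_trans BG _; rewrite lee_wpmul2l.
have JM : J <= c2%:E * M by apply: le_trans JY _; rewrite lee_wpmul2l.
have BJM : 1 + B + J <= (1 + c1 + c2)%:E * M.
  rewrite !EFinD !ge0_muleDl ?adde_ge0// mul1e; exact: leeD (leeD M1 BM) JM.
have SM : 1 + S <= (1 + k0 * (1 + c1 + c2))%:E * M.
  rewrite EFinD ge0_muleDl ?lee_fin ?mulr_ge0 ?addr_ge0// mul1e; apply: leeD M1 _.
  by apply: le_trans SBJ _; rewrite EFinM -muleA lee_wpmul2l.
by rewrite [in leRHS]EFinM -muleA lee_wpmul2l.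
Qed.
End auxiliary.

Section sobolev_poincare.
Context (R : realType) (n : nat) (Omega : set 'rV[R]_n.+1) (L q : R).
Hypothesis oOmega : open Omega.
Hypothesis OmegaL : Omega `<=` cube 0 L.
Hypothesis L0 : 0 < L.
Hypothesis q1 : 1 < q.
Local Open Scope ereal_scope.

Let int_bdry (g : 'rV[R]_n.+1 -> 'rV[R]_n.+1) : \bar R :=
  \int[surf R n.+1]_(x in bdry Omega) (frob (g x) `^ q)%:E.

Let int_ge0 d (T : measurableType d) (mu : {measure set T -> \bar R}) (D : set T) m k
  (f : T -> 'M[R]_(m, k)) : 0 <= \int[mu]_(x in D) (frob (f x) `^ q)%:E.
Proof. by apply: integral_ge0 => x _; rewrite lee_fin powR_ge0. Qed.

Lemma smooth_poincare : exists2 K : R, (0 < K)%R &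
  forall phi : 'rV[R]_n.+1 -> 'rV[R]_n.+1, (forall i, smooth (fun x => phi x ord0 i)) ->
  Lq_pow Omega q phi <= K%:E * (1 + int_bdry phi + Lq_pow Omega q (Defs.jacobian phi)).
Proof.
have [C C0 projC] := hausdorff_projection R n.
pose k := (2 * L * (n.+1%:R `^ q * 2 `^ q))%R; pose ell := ((2 * L) `^ (q - 1))%R.
have k0 : (0 < k)%R by rewrite !mulr_gt0 ?powR_gt0.
have ell0 : (0 <= ell)%R by exact: powR_ge0.
have a0 : (0 < (2 * L) ^+ n)%R by rewrite exprn_gt0 ?mulr_gt0.
pose m := ((2 * L) ^+ n + C * 2 + ell)%R.
have Cm : (C * 2 <= m)%R by rewrite /m addrAC lerDr addr_ge0// ltW.
have am : ((2 * L) ^+ n <= m)%R by rewrite /m -addrA lerDl addr_ge0// mulr_ge0 ?(ltW C0).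
have ellm : (ell <= m)%R by rewrite /m lerDr addr_ge0 ?(ltW a0)// mulr_ge0 ?(ltW C0).
have m0 : (0 < m)%R by exact: lt_le_trans am.
exists (k * m)%R => [|phi sphi]; first exact: mulr_gt0.
have := smooth_poincare_const oOmega OmegaL L0 q1 sphi C0 projC.
rewrite -/(Lq_pow Omega q phi) -/k -/ell -/(Lq_pow Omega q (Defs.jacobian phi)) -/(int_bdry phi).
move=> /le_trans; apply.
rewrite [(k * m)%:E]EFinM -[leRHS]muleA; apply: lee_wpmul2l; first by rewrite lee_fin ltW.
have ib0 : 0 <= int_bdry phi by exact: int_ge0.
have ij0 : 0 <= Lq_pow Omega q (Defs.jacobian phi) by exact: int_ge0.
move: (int_bdry phi) (Lq_pow Omega q (Defs.jacobian phi)) ib0 ij0 => X Y X0 Y0.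
rewrite [leRHS]ge0_muleDr ?adde_ge0// [X in _ <= X + _]ge0_muleDr// mule1 muleA -EFinM.
by apply: leeD; [apply: leeD|]; rewrite ?lee_fin// lee_wpmul2r// lee_fin.
Qed.

Lemma measurable_fun_borel_surf d (T : measurableType d) (D : set 'rV[R]_n.+1)
    (f : 'rV[R]_n.+1 -> T) :
  measurable D -> measurable_fun D f ->
  measurable_fun (D : set (surfaceType R n.+1)) (f : surfaceType R n.+1 -> T).
Proof. by move=> mD mf _ B mB; apply: hausdorff_borel; exact: mf. Qed.

(** Only one smooth function of the approximating sequence is used, one for
    which the three errors are at most 1; hence the constant 1 in the bound. *)
Lemma trace_poincare : exists2 K : R, (0 < K)%R &
  forall xi g : 'rV[R]_n.+1 -> 'rV[R]_n.+1, W1q Omega q xi ->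
  measurable_fun (bdry Omega : set (surfaceType R n.+1)) (g : surfaceType R n.+1 -> 'rV[R]_n.+1) ->
  has_trace Omega q xi g ->
  Lq_pow Omega q xi <= K%:E * (1 + int_bdry g + Lq_pow Omega q (wgrad Omega xi)).
Proof.
have [K0 K0_0 smoothK] := smooth_poincare.
have q0 : (0 <= q)%R by rewrite ltW// (lt_trans _ q1).
pose c1 := ((1 * n.+1)%:R `^ q * 2 `^ q : R)%R.
pose c2 := ((n.+1 * n.+1)%:R `^ q * 2 `^ q : R)%R.
have c10 : (0 < c1)%R by rewrite mulr_gt0 ?powR_gt0// ltr0n.
have c20 : (0 < c2)%R by rewrite mulr_gt0 ?powR_gt0// ltr0n.
exists (c1 * (1 + K0 * (1 + c1 + c2)))%R.
  by rewrite !mulr_gt0 ?addr_gt0 ?mulr_gt0 ?addr_gt0.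
move=> xi g [[mxi _] _ [mD _]] mg [phi [sphi phi_xi phi_D phi_g]].
have near1 (u : nat -> \bar R) : u @ \oo --> 0 -> \forall k \near \oo, u k <= 1.
  move=> /fine_cvgP[ufin /cvgrPdist_le u0].
  near=> k.
  have : u k \is a fin_num by near: k.
  move=> /fineK <-; rewrite lee_fin.
  have : (`|0 - fine (u k)| <= 1)%R by near: k; exact: u0.
  by rewrite sub0r normrN; exact/le_trans/ler_norm.
have [k [[k_xi k_D] k_g]] : exists k, ((Lq_pow Omega q (fun x => phi k x - xi x)%R <= 1 /\
    Lq_pow Omega q (fun x => Defs.jacobian (phi k) x - wgrad Omega xi x)%R <= 1) /\
    int_bdry (fun x => phi k x - g x)%R <= 1).
  have [N _ /(_ N (leqnn N)) hN] :=
    filterI (filterI (near1 _ phi_xi) (near1 _ phi_D)) (near1 _ phi_g).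
  by exists N.
have mOmega : measurable Omega by exact: open_measurable_rV.
have mbdry := measurable_bdry Omega.
have msphi := measurable_smooth (sphi k).
have mjphi := measurable_jacobian (sphi k).
have mlOmega := leb_borel mOmega; have sbdry := @hausdorff_borel R n.+1 n _ mbdry.
have lphi := measurable_fun_borel_leb mOmega (measurable_funTS msphi).
have ljphi := measurable_fun_borel_leb mOmega (measurable_funTS mjphi).
have bphi := measurable_fun_borel_surf mbdry (measurable_funTS msphi).
have t_xi : Lq_pow Omega q xi <= c1%:E * (1 + Lq_pow Omega q (phi k)).
  apply: le_trans (_ : _ <= c1%:E * (Lq_pow Omega q (fun x => phi k x - xi x)%R +
    Lq_pow Omega q (phi k))) _.
    exact: (power_triangle (leb R n.+1) mlOmega q0 mxi lphi).
  by apply: lee_wpmul2l; [rewrite lee_fin ltW|exact: (leeD2r _ k_xi)].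
have t_D : Lq_pow Omega q (Defs.jacobian (phi k)) <= c2%:E * (1 + Lq_pow Omega q (wgrad Omega xi)).
  apply: le_trans (_ : _ <= c2%:E *
    (Lq_pow Omega q (fun x => wgrad Omega xi x - Defs.jacobian (phi k) x)%R +
     Lq_pow Omega q (wgrad Omega xi))) _.
    exact: (power_triangle (leb R n.+1) mlOmega q0 ljphi mD).
  apply: lee_wpmul2l; [by rewrite lee_fin ltW|apply: leeD2r].
  apply: le_trans k_D; rewrite /Lq_pow; under eq_integral do rewrite frob_subC.
  exact: lexx.
have t_g : int_bdry (phi k) <= c1%:E * (1 + int_bdry g).
  apply: le_trans (_ : _ <= c1%:E * (int_bdry (fun x => g x - phi k x)%R + int_bdry g)) _.
    exact: (power_triangle (surf R n.+1) sbdry q0 bphi mg).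
  apply: lee_wpmul2l; [by rewrite lee_fin ltW|apply: leeD2r].
  apply: le_trans k_g; rewrite /int_bdry; under eq_integral do rewrite frob_subC.
  exact: lexx.
have := smoothK (phi k) (sphi k); move: t_xi t_D t_g.
have := int_ge0 (surf R n.+1) (bdry Omega) g; rewrite -/(int_bdry g).
have := int_ge0 (leb R n.+1) Omega (wgrad Omega xi); rewrite -/(Lq_pow Omega q (wgrad Omega xi)).
move: (Lq_pow _ _ xi) (Lq_pow _ _ (phi k)) (Lq_pow _ _ (Defs.jacobian _)) (Lq_pow _ _ (wgrad _ _))
  (int_bdry (phi k)) (int_bdry g) => X S J Y B G Y0 G0 XS JY BG SBJ.
apply: le_trans XS _; apply: chain_bound SBJ BG JY => //; exact: ltW.
Unshelve. all: by end_near. Qed.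

End sobolev_poincare.

(** * Coercivity *)

Lemma bounded_set_cube (R : realType) n (Omega : set 'rV[R]_n) : bounded_set Omega ->
  exists2 L, 0 < L & Omega `<=` cube 0 L.
Proof.
move=> [M [Mreal HM]]; exists (`|M| + 1); first by rewrite ltr_wpDl.
move=> x Ox j; rewrite mxE subr0.
apply: le_trans (HM (`|M| + 1) _ x Ox); last first.
  by rewrite (le_lt_trans (ler_norm M))// ltrDl.
rewrite /Num.norm/= mx_normrE.
exact: (le_bigmax _ (fun i : 'I_1 * 'I_n => `|x i.1 i.2|) (ord0, j)).
Qed.

Lemma ae_impl d (T : measurableType d) (R : realType) (mu : {measure set T -> \bar R})
    (P Q : T -> Prop) : (forall x, P x -> Q x) ->
  {ae mu, forall x, P x} -> {ae mu, forall x, Q x}.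
Proof.
by move=> PQ [N [mN N0 PN]]; exists N; split=> // x Qx; apply: PN => /PQ.
Qed.

Section coercivity.
Context (R : realType) (n : nat) (Omega : set 'rV[R]_n.+1) (L q : R).
Hypothesis oOmega : open Omega.
Hypothesis OmegaL : Omega `<=` cube 0 L.
Hypothesis L0 : 0 < L.
Hypothesis q1 : 1 < q.
Local Open Scope ereal_scope.

Lemma leb_le_cube : leb R n.+1 Omega <= ((2 * L) ^+ n.+1)%:E.
Proof.
apply: le_trans (le_outer_measure (lebesgue_outer R n.+1) _ _ OmegaL) _.
rewrite -[lebesgue_outer _ _ _]/(leb R n.+1 _) leb_borelE; last exact: measurable_cube.
by rewrite lebesgue_borel_cube// ltW.
Qed.

Lemma W1q_norm_powR xi :
  W1q_norm Omega q xi `^ q = Lq_pow Omega q xi + Lq_pow Omega q (wgrad Omega xi).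
Proof.
rewrite /W1q_norm -poweRrM mulVf ?gt_eqF ?(lt_trans _ q1)// poweRe1// adde_ge0//;
  by apply: integral_ge0 => x _; rewrite lee_fin powR_ge0.
Qed.

Lemma bdry_norm_ge (g : 'rV[R]_n.+1 -> 'rV[R]_n.+1) (gnorm : R) : bdry_norm Omega q g = gnorm%:E ->
  \int[surf R n.+1]_(x in bdry Omega) (frob (g x) `^ q)%:E <= (gnorm `^ q)%:E.
Proof.
move=> gE; rewrite -poweR_EFin -gE /bdry_norm -poweRrM mulVf ?gt_eqF ?(lt_trans _ q1)//.
have seminorm0 : 0 <= \int[surf R n.+1]_(x in bdry Omega) \int[surf R n.+1]_(y in bdry Omega)
    (frob (g x - g y)%R `^ q / frob (x - y)%R `^ (n.+1%:R + q - 2))%:E.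
  apply: integral_ge0 => x _; apply: integral_ge0 => y _.
  by rewrite lee_fin divr_ge0 ?powR_ge0.
have g0 : 0 <= \int[surf R n.+1]_(x in bdry Omega) (frob (g x) `^ q)%:E.
  by apply: integral_ge0 => x _; rewrite lee_fin powR_ge0.
rewrite poweRe1; last exact: adde_ge0.
exact: leeDl.
Qed.

(** Writing [X] and [Y] for the q-th powers of the norms of [xi] and of its
    gradient, [X <= K (1 + gnorm^q + Y)] gives
    [X + Y <= (K + 1) (Y + 1 + gnorm^q)], whence the constants. *)
Lemma coercivity (a b gnorm : R) : (0 < a)%R -> (0 <= b)%R ->
  exists cI CI : R, [/\ (0 < cI)%R, (0 <= CI)%R &
    forall (W : 'rV[R]_n.+1 -> \bar R) (xi g : 'rV[R]_n.+1 -> 'rV[R]_n.+1),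
    {ae leb R n.+1, forall x, Omega x ->
      (a * frob (wgrad Omega xi x) `^ q - b)%:E <= W x} ->
    bdry_space Omega q g -> bdry_norm Omega q g = gnorm%:E ->
    admissible Omega q g xi ->
    cI%:E * W1q_norm Omega q xi `^ q - CI%:E <= \int[leb R n.+1]_(x in Omega) W x].
Proof.
move=> a0 b0; have [K K0 poincare] := trace_poincare oOmega OmegaL L0 q1.
pose V := ((2 * L) ^+ n.+1)%R; have V0 : (0 <= V)%R by rewrite exprn_ge0// mulr_ge0// ltW.
pose gq := (gnorm `^ q)%R; have gq0 : (0 <= gq)%R by exact: powR_ge0.
have K1 : (0 < K + 1)%R by rewrite addr_gt0.
exists (a / (K + 1))%R, (a * (1 + gq) + 2 * (b * V))%R; split.
- by rewrite divr_gt0.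
- by rewrite addr_ge0 ?mulr_ge0 ?addr_ge0 ?(ltW a0).
move=> W xi g Wge [mg _] gE [xiW xi_trace].
have [[mxi xi_fin] _ [mD D_fin]] := xiW.
have mOmega := leb_borel (open_measurable_rV oOmega).
have Omega_fin : leb R n.+1 Omega < +oo by apply: le_lt_trans leb_le_cube _; rewrite ltry.
have mpow := measurableT_comp (measurable_powR q) (measurable_frob mD).
have Yint : \int[leb R n.+1]_(x in Omega) (a * frob (wgrad Omega xi x) `^ q)%:E =
    a%:E * Lq_pow Omega q (wgrad Omega xi).
  under eq_integral do rewrite EFinM.
  have mE := (measurable_EFinP _ _).2 mpow.
  apply: (ge0_integralZl (leb R n.+1) mOmega mE); last by rewrite lee_fin ltW.
  by move=> x _; rewrite lee_fin powR_ge0.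
have mF : measurable_fun (Omega : set (lebesgueType R n.+1))
    (fun x : lebesgueType R n.+1 => (a * frob (wgrad Omega xi x) `^ q)%R).
  by apply: measurable_funM; [exact: measurable_cst|exact: mpow].
have F0 (x : lebesgueType R n.+1) : (0 <= a * frob (wgrad Omega xi x) `^ q)%R.
  by rewrite mulr_ge0 ?powR_ge0// ltW.
have := ae_integral_ge mOmega Omega_fin mF F0 b0 Wge.
rewrite Yint => /(le_trans _); apply.
have := poincare xi g xiW mg xi_trace; have := bdry_norm_ge gE.
rewrite W1q_norm_powR.
have vE : leb R n.+1 Omega = (fine (leb R n.+1 Omega))%:E.
  by rewrite fineK// ge0_fin_numE.
have vV : (fine (leb R n.+1 Omega) <= V)%R by rewrite -lee_fin -vE leb_le_cube.
have X0 : 0 <= Lq_pow Omega q xi by apply: integral_ge0 => x _; rewrite lee_fin powR_ge0.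
have Y0 : 0 <= Lq_pow Omega q (wgrad Omega xi).
  by apply: integral_ge0 => x _; rewrite lee_fin powR_ge0.
have G0 : 0 <= \int[surf R n.+1]_(x in bdry Omega) (frob (g x) `^ q)%:E.
  by apply: integral_ge0 => x _; rewrite lee_fin powR_ge0.
rewrite vE; move: (fine _) vV => v vV.
move: (Lq_pow Omega q xi) (Lq_pow Omega q (wgrad Omega xi))
  (\int[surf R n.+1]_(x in bdry Omega) (frob (g x) `^ q)%:E) X0 Y0 G0 xi_fin D_fin.
move=> [X| |] [Y| |] [G| |]//; rewrite -/gq !lee_fin => X0 Y0 G0 _ _ Ggq XY.
have {}XY : (X <= K * (1 + gq + Y))%R.
  by apply: le_trans XY _; rewrite ler_pM2l// lerD2r lerD2l.
have bv : (b * v <= b * V)%R by rewrite ler_wpM2l.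
have aXY : (a / (K + 1) * (X + Y) <= a * (Y + (1 + gq)))%R.
  rewrite mulrAC -mulrA ler_pM2l// ler_pdivrMr//.
  have : (0 <= 1 + gq)%R by rewrite addr_ge0.
  lra.
lra.
Qed.
End coercivity.

Theorem proposition3p5 (R : realType) (d : nat) (Omegap : set 'rV[R]_d)
    (gamma m0 m1 : R) :
  (2 <= d)%N -> polyhedral_domain Omegap -> 1 < gamma -> 0 < m0 -> 0 < m1 ->
  let p := d%:R * gamma / 2 in
  let q := 2 * p in
  let rho0 := m0 `^ (d%:R / 2) in
  let rho1 := m1 `^ (d%:R / 2) in
  (forall (Omegac : set 'rV[R]_d) (M : 'rV[R]_d -> 'M[R]_d),
     domain Omegac -> (0 < leb R d Omegac < +oo)%E ->
     SPD_field Omegap M -> uniform_bounds Omegap m0 m1 M ->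
     let theta := theta_of Omegap Omegac M in
     {ae leb R d, forall x, Omegap x ->
        forall (A P : 'M[R]_d) (c : R), SPD A -> 0 < \det P -> 0 < c < 1 ->
        let B := P *m invmx (M x) *m P^T in
        G_density p theta A (\det A) (M x)
          >= c * rho0 * (\tr A) `^ p - rho1 * C_const d p theta c /\
        G_density p theta B (\det B) (M x)
          >= c * rho0 * m1 `^ (- p) * frob P `^ q - rho1 * C_const d p theta c})
  /\
  (forall c theta gnorm : R, 0 < c < 1 ->
   exists cI CI : R, [/\ 0 < cI, 0 <= CI &
     forall (Omegac : set 'rV[R]_d) (M : 'rV[R]_d -> 'M[R]_d)
            (g : 'rV[R]_d -> 'rV[R]_d),
     domain Omegac -> (0 < leb R d Omegac < +oo)%E ->
     SPD_field Omegap M -> uniform_bounds Omegap m0 m1 M ->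
     theta_of Omegap Omegac M = theta ->
     bdry_space Omegap q g -> bdry_norm Omegap q g = gnorm%:E ->
     forall xi, admissible Omegap q g xi ->
     (I_functional Omegap p theta M xi
        >= cI%:E * (W1q_norm Omegap q xi) `^ q - CI%:E)%E]).
Proof.
move=> d2 [[oOmega _ _] bOmega _ _] gamma1 m00 m10 p q rho0 rho1.
have d0 : (0 < d)%N by exact: leq_trans d2.
have dR : 2 <= d%:R :> R by rewrite ler_nat.
have p1 : 1 < p.
  rewrite /p ltr_pdivlMr// mul1r (lt_le_trans (_ : 2 < 2 * gamma))//.
    by rewrite ltr_pMr.
  by rewrite ler_wpM2r// ltW// (lt_trans _ gamma1).
have p0 : 0 < p by exact: lt_trans p1.
split=> [Omegac M _ _ [_ MSPD] Mbounds theta|c theta gnorm c01].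
  apply: (ae_impl _ Mbounds) => x Mx Ox A P c pA P0 c01.
  have [m0M Mm1] := Mx Ox; split.
    exact: (G_density_ge theta d0 p0 c01 m00 m10 pA (MSPD x Ox) m0M Mm1).
  exact: (G_density_frob_ge theta d0 p0 c01 m00 m10 P0 (MSPD x Ox) m0M Mm1).
have q1 : 1 < q by rewrite /q; move: p1; lra.
case: d => [//|n] in Omegap d2 p q rho0 rho1 oOmega bOmega d0 dR p1 p0 q1 *.
have [L L0 OmegaL] := bounded_set_cube bOmega.
have a0 : 0 < c * rho0 * m1 `^ (- p).
  by case/andP: c01 => c0 _; rewrite !mulr_gt0// powR_gt0.
have b0 : 0 <= rho1 * C_const n.+1 p theta c.
  by rewrite mulr_ge0 ?powR_ge0// C_const_ge0.
have [cI [CI [cI0 CI0 main]]] := coercivity oOmega OmegaL L0 q1 gnorm a0 b0.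
exists cI, CI; split=> // Omegac M g _ _ [_ MSPD] Mbounds _ gspace gE xi xiA.
apply: (main (fun x => W_density p theta (M x) (wgrad Omegap xi x)) xi g) => //.
apply: (ae_impl _ Mbounds) => x Mx Ox; have [m0M Mm1] := Mx Ox.
rewrite /W_density; case: ifPn => P0; last exact: leey.
rewrite lee_fin.
exact: (G_density_frob_ge theta d0 p0 c01 m00 m10 P0 (MSPD x Ox) m0M Mm1).
Qed.
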